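(* Let $n\ge 2$, let $k$ be a field of characteristic zero, let $R=k[[x_1,\ldots,x_n]]$, and let $f\in R$ define a hypersurface $R/\langle f\rangle$ with an isolated singularity (at the null point). Then: (i) $\mu_f-\tau_f=\lambda(I_f^2/J_fI_f)+\lambda(\delta(I_f))$. In particular, $\mu_f-\tau_f=\lambda(\delta(I_f))$ if and only if the reduction number of $I_f$ relative to $J_f$ is $1$. (ii) The following are equivalent: (a) $R/\langle f\rangle$ is quasihomogeneous; (b) $\delta(I_f)=0$. (iii) If $\mu_f-\tau_f=1$, then $I_f^2=J_fI_f$.
   Context: Write $J_f=\langle \partial f/\partial x_1,\ldots,\partial f/\partial x_n\rangle\subset R$ and $I_f=\langle f, J_f\rangle\subset R$. That $R/\langle f\rangle$ has an isolated singularity (at the null point) means that $f$ and all $\partial f/\partial x_i$ lie in the maximal ideal $\langle x_1,\ldots,x_n\rangle$ of $R$ and that $J_f$ and $I_f$ are primary to this maximal ideal. $\lambda$ denotes length of $R$-modules. The Milnor number is $\mu_f=\dim_k R/J_f=\lambda(R/J_f)$ and the Tjurina number is $\tau_f=\dim_k R/I_f=\lambda(R/I_f)$. $R/\langle f\rangle$ is called quasihomogeneous if $f\in J_f$ (equivalently, $I_f=J_f$, equivalently $\mu_f=\tau_f$). $\delta(I_f)$ denotes the kernel of the natural surjection $\mathrm{Sym}^2_R(I_f)\to I_f^2$ from the second symmetric power of $I_f$ onto $I_f^2$. An ideal $J\subseteq I$ is a reduction of $I$ if $JI^m=I^{m+1}$ for a sufficiently large $m$; the reduction number of $I$ relative to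 $J$ is $\min\{t : JI^m=I^{m+1}\text{ for all } m\ge t\}$. (It is known that $J_f$ is a reduction of $I_f$.) *)

(* Defs.v *)
From HB Require Import structures.
From mathcomp Require Import all_boot all_algebra generic_quotient ring_quotient.
From mathcomp Require Import boolp.
From mathcomp Require Import freeg mpoly.

Set Implicit Arguments.
Unset Strict Implicit.
Unset Printing Implicit Defensive.

Import GRing.Theory.
Local Open Scope ring_scope.
Local Open Scope quotient_scope.

Section PowerSeriesRing.
Variables (n : nat) (k : comNzRingType).

Record fps := Fps { fpscoef :> 'X_{1..n} -> k }.

HB.instance Definition _ := gen_eqMixin fps.
HB.instance Definition _ := gen_choiceMixin fps.

Lemma fpsP (f g : fps) : (forall m, f m = g m) -> f = g.
Proof. by case: f g => f [g] /= /funext ->. Qed.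

Definition fpsC (c : k) := Fps (fun m => if m == 0%MM then c else 0).
Definition fpsX (i : 'I_n) := Fps (fun m => (m == U_(i)%MM)%:R).
Definition fps_add (f g : fps) := Fps (fun m => f m + g m).
Definition fps_opp (f : fps) := Fps (fun m => - f m).
(* Cauchy product; the degree bounds only make the index type finite. *)
Definition fps_mul (f g : fps) := Fps (fun m =>
  \sum_(a : 'X_{1..n < (mdeg m).+1, (mdeg m).+1} | m == (a.1 + a.2)%MM)
     f a.1 * g a.2).

Lemma fps_addA : associative fps_add.
Proof. by move=> f g h; apply: fpsP => m /=; rewrite addrA. Qed.
Lemma fps_addC : commutative fps_add.
Proof. by move=> f g; apply: fpsP => m /=; rewrite addrC. Qed.
Lemma fps_add0 : left_id (fpsC 0) fps_add.
Proof. by move=> f; apply: fpsP => m /=; rewrite if_same add0r. Qed.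
Lemma fps_addN : left_inverse (fpsC 0) fps_opp fps_add.
Proof. by move=> f; apply: fpsP => m /=; rewrite if_same addNr. Qed.

HB.instance Definition _ :=
  GRing.isZmodule.Build fps fps_addA fps_addC fps_add0 fps_addN.

Definition fps_trunc d (f : fps) : {mpoly k[n]} :=
  \sum_(m : 'X_{1..n < d}) f m *: 'X_[m].

Lemma fps_mulE (f g : fps) (p q : {mpoly k[n]}) m :
    (forall m', (mdeg m' <= mdeg m)%N -> p@_m' = f m') ->
    (forall m', (mdeg m' <= mdeg m)%N -> q@_m' = g m') ->
  fps_mul f g m = (p * q)@_m.
Proof.
move=> pf qg; rewrite mcoeffM /=; apply: eq_bigr => -[[a lea] [b leb]] /= _.
by rewrite pf // qg.
Qed.

Lemma fps_truncE d (f : fps) m : (mdeg m < d)%N -> (fps_trunc d f)@_m = f m.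
Proof. exact: mcoeff_mpoly. Qed.

Let tr (m : 'X_{1..n}) f := fps_trunc (mdeg m).+1 f.
Let trE m f m' : (mdeg m' <= mdeg m)%N -> (tr m f)@_m' = f m'.
Proof. by move=> le; apply: fps_truncE; rewrite ltnS. Qed.
Let trM m f g m' : (mdeg m' <= mdeg m)%N ->
  (tr m f * tr m g)@_m' = fps_mul f g m'.
Proof.
by move=> le; rewrite -(fps_mulE (f := f) (g := g)) // => a /leq_trans/(_ le);
  exact: trE.
Qed.

Lemma fps_mulA : associative fps_mul.
Proof.
move=> f g h; apply: fpsP => m.
rewrite (fps_mulE (p := tr m f) (q := tr m g * tr m h)); last 2 first.
- exact: trE.
- exact: trM.
rewrite mulrA; apply/esym/fps_mulE; [exact: trM | exact: trE].
Qed.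

Lemma fps_mulC : commutative fps_mul.
Proof.
move=> f g; apply: fpsP => m.
rewrite (fps_mulE (p := tr m f) (q := tr m g)); try exact: trE.
by rewrite mulrC; apply/esym/fps_mulE; exact: trE.
Qed.

Lemma fps_mul1 : left_id (fpsC 1) fps_mul.
Proof.
move=> f; apply: fpsP => m.
rewrite (fps_mulE (p := 1) (q := tr m f)); last exact: trE.
  by rewrite mul1r trE.
by move=> m' _; rewrite mcoeff1 /=; case: ifP.
Qed.

Lemma fps_mulDl : left_distributive fps_mul fps_add.
Proof.
move=> f g h; apply: fpsP => m /=; rewrite -big_split /=.
by apply: eq_bigr => a _; rewrite mulrDl.
Qed.

Lemma fps_1neq0 : fpsC 1 != 0.
Proof.
apply/eqP => /(congr1 (fun f : fps => f 0%MM)) /= /eqP.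
by rewrite eqxx oner_eq0.
Qed.

HB.instance Definition _ := GRing.Zmodule_isComNzRing.Build fps
  fps_mulA fps_mulC fps_mul1 fps_mulDl fps_1neq0.

Definition fps_deriv (i : 'I_n) (f : fps) : fps :=
  Fps (fun m => f (m + U_(i))%MM *+ (m i).+1).

End PowerSeriesRing.

Section Modules.
Variables (R : comNzRingType) (M : lmodType R).

Section Span.
Variable S : M -> Prop.

Definition span : {pred M} := [pred x | `[<
  exists (r : nat) (c : 'I_r -> R) (v : 'I_r -> M),
    (forall i, S (v i)) /\ x = \sum_i c i *: v i >]].

Lemma span_submod : subsemimod_closed span.
Proof.
split; first split.
- apply/asboolP; exists 0, (fun _ => 0), (fun _ => 0); split; first by case.
  by rewrite big_ord0.
- move=> _ _ /asboolP[r [c [v [Sv ->]]]] /asboolP[s [d [w [Sw ->]]]].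
  apply/asboolP; pose e T (a : 'I_r -> T) b (i : 'I_(r + s)) :=
    match split i with inl j => a j | inr j => b j end.
  exists (r + s)%N, (e _ c d), (e _ v w); split.
    by move=> i; rewrite /e; case: split.
  rewrite big_split_ord /e /=; congr (_ + _); apply: eq_bigr => i _.
    by rewrite (unsplitK (inl i)).
  by rewrite (unsplitK (inr i)).
move=> a _ /asboolP[r [c [v [Sv ->]]]].
apply/asboolP; exists r, (fun i => a * c i), v; split=> //.
by rewrite scaler_sumr; apply: eq_bigr => i _; rewrite scalerA.
Qed.

HB.instance Definition _ :=
  GRing.isSubSemiModClosed.Build R M span span_submod.
End Span.

Section SubAndQuotient.
Variable N : submodClosed M.

Record submod := Submod { submod_val : M; _ : submod_val \in N }.
HB.instance Definition _ := [isSub for submod_val].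
HB.instance Definition _ := [Choice of submod by <:].
HB.instance Definition _ := [SubChoice_isSubLmodule of submod by <:].

Lemma submod_zmod_closed : zmod_closed N.
Proof. exact: (GRing.submod_closedB (submodClosedP N)). Qed.

(* MathComp's submodClosed does not record closure under opposite, which
   Quotient.quot requires. *)
Definition zmod_of : zmodClosed M :=
  HB.pack_for (zmodClosed M) (GRing.SubmodClosed.sort N)
    (GRing.isZmodClosed.Build M (GRing.SubmodClosed.sort N) submod_zmod_closed).

Definition quotmod := Quotient.quot zmod_of.
HB.instance Definition _ := GRing.Zmodule.on quotmod.
HB.instance Definition _ := EqQuotient.on quotmod.

Lemma quotmod_eqP (x y : M) : (x - y \in N) = (x == y %[mod quotmod]).
Proof. exact: (Quotient.idealrBE zmod_of). Qed.

Lemma quotmod_piD (x y : M) : \pi_quotmod (x + y) = \pi_quotmod x + \pi_quotmod y.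
Proof. exact: (@Quotient.pi_add _ zmod_of). Qed.

Definition quotmod_scale (a : R) (q : quotmod) : quotmod :=
  \pi_quotmod (a *: repr q).

Lemma quotmod_piZ a (x : M) :
  \pi_quotmod (a *: x) = quotmod_scale a (\pi_quotmod x).
Proof.
apply/eqP; rewrite -quotmod_eqP -scalerBr rpredZ //.
by rewrite quotmod_eqP reprK.
Qed.

Lemma quotmod_scaleA a b q :
  quotmod_scale a (quotmod_scale b q) = quotmod_scale (a * b) q.
Proof. by elim/quotW: q => x; rewrite -(quotmod_piZ b x) -!quotmod_piZ scalerA. Qed.
Lemma quotmod_scale1 : left_id 1 quotmod_scale.
Proof. by elim/quotW => x; rewrite -!quotmod_piZ scale1r. Qed.
Lemma quotmod_scaleDr : right_distributive quotmod_scale +%R.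
Proof.
move=> a q r; elim/quotW: q => x; elim/quotW: r => y.
by rewrite -quotmod_piD -(quotmod_piZ a x) -(quotmod_piZ a y) -quotmod_piZ
  scalerDr quotmod_piD.
Qed.
Lemma quotmod_scaleDl q : {morph quotmod_scale^~ q : a b / a + b}.
Proof.
by elim/quotW: q => x a b; rewrite -!quotmod_piZ scalerDl quotmod_piD.
Qed.

HB.instance Definition _ := GRing.Zmodule_isLmodule.Build R quotmod
  quotmod_scaleA quotmod_scale1 quotmod_scaleDr quotmod_scaleDl.

End SubAndQuotient.
End Modules.

Section Subquotient.
Variables (R : comNzRingType) (M : lmodType R).

(* L, or rather its intersection with N, as a submodule of the module N; hence
   subquotmod N L is N / L when L is contained in N. *)
Definition submod_in (N L : submodClosed M) : {pred submod N} :=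
  [pred x | submod_val x \in L].
Arguments submod_in : clear implicits.

Lemma submod_in_closed (N L : submodClosed M) :
  subsemimod_closed (submod_in N L).
Proof.
split; first split.
- exact: (rpred0 L).
- by move=> x y Lx Ly; apply: (rpredD Lx Ly).
- by move=> a x Lx; apply: (rpredZ a Lx).
Qed.

HB.instance Definition _ (N L : submodClosed M) :=
  GRing.isSubSemiModClosed.Build R (submod N) (submod_in N L)
    (submod_in_closed N L).

Definition subquotmod (N L : submodClosed M) := quotmod (submod_in N L).

End Subquotient.

Section Length.
Variables (R : comNzRingType) (M : lmodType R).

Definition has_chain (l : nat) :=
  exists C : nat -> submodClosed M, forall i, (i < l)%N ->
    {subset C i <= C i.+1} /\ exists2 x, x \in C i.+1 & x \notin C i.

Definition has_length (l : nat) :=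
  has_chain l /\ forall l', has_chain l' -> (l' <= l)%N.

End Length.

Section Kernel.
Variables (R : comNzRingType) (M M' : lmodType R) (phi : {linear M -> M'}).

Definition ker_lin : {pred M} := [pred x | phi x == 0].

Lemma ker_lin_closed : subsemimod_closed ker_lin.
Proof.
split; first split; rewrite ?inE ?raddf0 //.
  by move=> x y; rewrite !inE => /eqP x0 /eqP y0; rewrite raddfD /= x0 y0 addr0.
by move=> a x; rewrite !inE => /eqP x0; rewrite linearZ /= x0 scaler0.
Qed.

HB.instance Definition _ :=
  GRing.isSubSemiModClosed.Build R M ker_lin ker_lin_closed.

End Kernel.

Section SymmetricSquare.
Variables (R : comNzRingType) (M : lmodType R).
Local Notation F := {freeg (M * M)%type / R}.
Local Notation e x y := (<< (x, y) >> : F).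

Inductive sym2_rel : F -> Prop :=
| Sym2_addl x y z : sym2_rel (e (x + y) z - e x z - e y z)
| Sym2_addr x y z : sym2_rel (e x (y + z) - e x y - e x z)
| Sym2_scalel a x y : sym2_rel (e (a *: x) y - a *: e x y)
| Sym2_scaler a x y : sym2_rel (e x (a *: y) - a *: e x y)
| Sym2_swap x y : sym2_rel (e x y - e y x).

Definition sym2 := quotmod (span sym2_rel).

HB.instance Definition _ := GRing.Lmodule.on sym2.

Definition sym2_mul (x y : M) : sym2 := \pi_(sym2) (e x y).
End SymmetricSquare.

Section Ideals.
Variable R : comNzRingType.
Local Notation ideal := (submodClosed R^o).

Definition idealM (I J : ideal) : ideal :=
  span (fun z : R^o => exists x y, [/\ x \in I, y \in J & z = x * y]).

Definition ideal1 : ideal := span (fun z : R^o => z = 1).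

Definition idealX (I : ideal) (m : nat) : ideal := iterop m idealM I ideal1.

Definition primary (Q : ideal) : Prop :=
  1 \notin Q /\
  forall a b : R, a * b \in Q -> a \in Q \/ exists m, b ^+ m \in Q.

Definition primary_to (Q P : ideal) : Prop :=
  primary Q /\ forall a : R, a \in P <-> exists m, a ^+ m \in Q.

(* The minimum is taken over positive exponents t.  This matters only when
   J = I, where t = 0 would qualify (as I ^ 0 is the unit ideal) although
   J I = I ^ 2: here the reduction number of I relative to itself is 1. *)
Definition has_reduction_number (J I : ideal) (t : nat) : Prop :=
  let stable s := forall m, (s <= m)%N ->
    idealM J (idealX I m) =i idealX I m.+1 in
  [/\ (0 < t)%N, stable t & forall s, (0 < s)%N -> stable s -> (t <= s)%N].

End Ideals.

Notation ideal R := (submodClosed R^o).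

Section Delta.
Variables (R : comNzRingType) (I : ideal R).
Local Notation pairs := (submod I * submod I)%type.
Local Notation F := {freeg pairs / R}.

Definition free_prod : F -> R^o :=
  fglift (fun p : pairs => (submod_val p.1 : R) * submod_val p.2 : R^o).

Lemma free_prodU (a : R) (x y : submod I) :
  free_prod << a *g (x, y) >> = a * (submod_val x * submod_val y).
Proof. exact: liftU. Qed.

Lemma free_prodB : {morph free_prod : u v / u - v}.
Proof. exact: lift_is_additive. Qed.

HB.instance Definition _ := GRing.isZmodMorphism.Build F R^o free_prod free_prodB.

Lemma free_prodE (v : F) :
  free_prod v = \sum_(p <- dom v)
    coeff p v * (submod_val p.1 * submod_val p.2 : R).
Proof.
rewrite -{1}[v]freeg_sumE raddf_sum; apply: eq_bigr => -[x y] _ /=.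
exact: free_prodU.
Qed.

Lemma free_prodZ : scalable free_prod.
Proof.
move=> a v; rewrite [a *: v]/(fgscale a v) /fgscale raddf_sum [in RHS]free_prodE scaler_sumr.
by apply: eq_bigr => -[x y] _; rewrite /= free_prodU /= -mulrA.
Qed.

HB.instance Definition _ := GRing.isScalable.Build R F R^o *:%R free_prod free_prodZ.

Lemma free_prod_in v : free_prod v \in idealX I 2.
Proof.
rewrite free_prodE; apply: rpred_sum => -[x y] _.
apply: (rpredZ (coeff _ v)); apply/asboolP.
exists 1%N, (fun=> 1), (fun=> submod_val x * submod_val y : R); split.
  by move=> _; exists (submod_val x), (submod_val y); split => //; exact: valP.
by rewrite big_ord1 scale1r.
Qed.

Lemma free_prod_rel v : sym2_rel v -> free_prod v = 0.
Proof.
case=> [x y z|x y z|a x y|a x y|x y]; rewrite !free_prodB ?free_prodZ.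
- by rewrite !free_prodU !mul1r mulrDl addrAC addrK subrr.
- by rewrite !free_prodU !mul1r mulrDr addrAC addrK subrr.
- by rewrite !free_prodU !mul1r; apply/eqP; rewrite subr_eq0 -mulrA.
- by rewrite !free_prodU !mul1r; apply/eqP; rewrite subr_eq0; apply/eqP/mulrCA.
- by rewrite !free_prodU !mul1r mulrC subrr.
Qed.

Lemma free_prod_span v : v \in span (@sym2_rel R (submod I)) -> free_prod v = 0.
Proof.
move=> /asboolP[r [c [w [relw ->]]]]; rewrite raddf_sum big1 // => i _.
by rewrite [LHS](free_prodZ (c i)) free_prod_rel ?scaler0.
Qed.

Definition sym2_to_sq (q : sym2 (submod I)) : submod (idealX I 2) :=
  Submod (free_prod_in (repr q)).

Lemma sym2_to_sq_pi v :
  submod_val (sym2_to_sq (\pi_(sym2 (submod I)) v)) = free_prod v.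
Proof.
apply/eqP; rewrite -subr_eq0 -[_ - _]free_prodB; apply/eqP/free_prod_span.
by rewrite quotmod_eqP reprK.
Qed.

Lemma sym2_to_sq_mul (x y : submod I) :
  submod_val (sym2_to_sq (sym2_mul x y)) =
  (submod_val x : R) * submod_val y.
Proof. by rewrite sym2_to_sq_pi free_prodU mul1r. Qed.

Lemma sym2_to_sq_linear : linear sym2_to_sq.
Proof.
move=> a q r; elim/quotW: q => u; elim/quotW: r => v; apply: val_inj.
have -> : a *: \pi_(sym2 (submod I)) u + \pi_(sym2 (submod I)) v = \pi_(sym2 (submod I)) (a *: u + v).
  by rewrite [RHS]quotmod_piD; congr (_ + _); apply/esym/quotmod_piZ.
transitivity (free_prod (a *: u + v)); first exact: sym2_to_sq_pi.
rewrite raddfD /= [X in X + _]free_prodZ.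
by rewrite -(sym2_to_sq_pi u) -(sym2_to_sq_pi v).
Qed.

HB.instance Definition _ := GRing.isLinear.Build R _ _ _ sym2_to_sq sym2_to_sq_linear.

Definition delta := submod (ker_lin sym2_to_sq).
End Delta.

Section Hypersurface.
Variables (n : nat) (k : fieldType).
Local Notation R := (fps n k).

Definition has_kdim (M : lmodType R) (d : nat) : Prop :=
  exists v : 'I_d -> M, forall x : M,
    exists! c : {ffun 'I_d -> k}, x = \sum_i fpsC n (c i) *: v i.

Definition maxideal : ideal R := span (fun g : R^o => exists i, g = fpsX k i).

Variable f : R.

Definition jacobian_ideal : ideal R :=
  span (fun g : R^o => exists i, g = fps_deriv i f).

Definition tjurina_ideal : ideal R :=
  span (fun g : R^o => g = f \/ exists i, g = fps_deriv i f).

Definition isolated_singularity : Prop :=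
  [/\ f \in maxideal, forall i, fps_deriv i f \in maxideal,
      primary_to jacobian_ideal maxideal & primary_to tjurina_ideal maxideal].

Definition has_milnor_number := has_kdim (quotmod jacobian_ideal).
Definition has_tjurina_number := has_kdim (quotmod tjurina_ideal).

Definition quasihomogeneous : Prop := f \in jacobian_ideal.

End Hypersurface.

(* Main.v *)
From HB Require Import structures.
Require Import Defs.
From mathcomp Require Import all_boot all_algebra generic_quotient.
From mathcomp Require Import boolp.
From mathcomp Require Import freeg mpoly ring.

Set Implicit Arguments.
Unset Strict Implicit.
Unset Printing Implicit Defensive.

Import GRing.Theory.
Local Open Scope ring_scope.
Local Open Scope quotient_scope.

Local Notation span := Defs.span.

(* Write p for the partials of f, so J = (p_1, ..., p_n) and I = (J, f), and put
   K = J : f, P = JI : f^2.  Then I/J = R/K and I^2/JI = R/P by multiplication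
   by f and f^2.  Since R has depth n, the partials have vanishing first Koszul
   homology, so c |-> c [f.f] - sum_i [a_i.p_i], where c f^2 = sum_i a_i p_i
   with a_i in I, is a well-defined isomorphism from P/K onto delta(I).  This
   gives mu - tau = length(R/K) = length(R/P) + length(P/K).

   It remains to see that P = K forces f in J.  If f is not in J, every syzygy
   of (p, f) has its entries in the maximal ideal: a unit in it would give a
   derivation D with D f in (f) and D x_j a unit, D would preserve I, and in
   characteristic 0 a power of x_j in I could be lowered down to 1.  So if s
   spans a simple submodule of R/I, s times any syzygy has entries in I, whence
   s K is contained in J.  As R/J is Gorenstein, J : K = J : (J : I) = I, so s
   would lie in I.  The Gorenstein property enters through the isomorphism of
   R/J with (Y : J)/Y for Y = (x_1^N, ..., x_n^N) in J, again read off the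
   Koszul complex, and the perfect pairing on R/Y. *)

(** * The Koszul complex, its differential and its homotopies *)

Section KoszulComplex.
Variable R : comNzRingType.

(* The total space of the Koszul complex on m generators e_0, ..., e_(m-1); the
   pair (a, b) in kos m.+1 stands for a + e_m b. *)
Fixpoint kos (m : nat) : lmodType R :=
  if m is m'.+1 then (kos m' * kos m')%type : lmodType R else R^o.

Implicit Types (f c : nat -> R) (Y : submodClosed R^o).

(** Contraction against f, the Koszul differential: e_m b goes to f_m b - e_m d b. *)
Fixpoint kosd f m : kos m -> kos m :=
  if m is m'.+1 return kos m -> kos m then
    fun z => (kosd f z.1 + f m' *: z.2, - kosd f z.2)
  else fun=> 0.

(** Left exterior multiplication by the sum of the c_i e_i; the sign comes from moving this vector
    past e_m. *)
Fixpoint kosh c m : kos m -> kos m :=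
  if m is m'.+1 return kos m -> kos m then
    fun z => (kosh c z.1, c m' *: z.1 - kosh c z.2)
  else fun=> 0.

(** Homogeneity of degree p in the exterior grading; 0 is homogeneous of every degree. *)
Fixpoint kos_hom m p : kos m -> Prop :=
  if m is m'.+1 return kos m -> Prop then
    fun z => kos_hom p z.1 /\ (if p is p'.+1 then kos_hom p' z.2 else z.2 = 0)
  else fun z => p = 0%N \/ z = 0.

Fixpoint kos_in Y m : kos m -> Prop :=
  if m is m'.+1 return kos m -> Prop then
    fun z => kos_in Y z.1 /\ kos_in Y z.2
  else fun z => z \in Y.

Lemma kos_eqP m (z w : kos m.+1) : z.1 = w.1 -> z.2 = w.2 -> z = w.
Proof. by case: z w => [a b] [a' b'] /= -> ->. Qed.

Lemma kosd_is_linear f m : linear (@kosd f m).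
Proof.
elim: m => [|m IHm] a z w; first by rewrite scaler0 addr0.
apply: kos_eqP => /=; rewrite IHm.
  rewrite !scalerDr !scalerA -!addrA; congr (_ + _).
  by rewrite addrCA (mulrC a).
by rewrite opprD scalerN.
Qed.
HB.instance Definition _ f m :=
  GRing.isLinear.Build R (kos m) (kos m) *:%R (@kosd f m) (@kosd_is_linear f m).

Lemma kosh_is_linear c m : linear (@kosh c m).
Proof.
elim: m => [|m IHm] a z w; first by rewrite scaler0 addr0.
apply: kos_eqP => /=; rewrite !IHm //.
by rewrite !(scalerDr, scalerN, scalerA) opprD addrACA (mulrC a).
Qed.
HB.instance Definition _ c m :=
  GRing.isLinear.Build R (kos m) (kos m) *:%R (@kosh c m) (@kosh_is_linear c m).

Lemma kosd0 f m : kosd f (0 : kos m) = 0. Proof. exact: linear0. Qed.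
Lemma kosh0 c m : kosh c (0 : kos m) = 0. Proof. exact: linear0. Qed.
Lemma kosdD f m : {morph @kosd f m : z w / z + w}. Proof. exact: linearD. Qed.
Lemma kosdB f m : {morph @kosd f m : z w / z - w}. Proof. exact: linearB. Qed.
Lemma kosdN f m : {morph @kosd f m : z / - z}. Proof. exact: linearN. Qed.
Lemma kosdZ f m a : {morph @kosd f m : z / a *: z}. Proof. by move=> z; rewrite linearZ. Qed.
Lemma koshD c m : {morph @kosh c m : z w / z + w}. Proof. exact: linearD. Qed.
Lemma koshN c m : {morph @kosh c m : z / - z}. Proof. exact: linearN. Qed.
Lemma koshZ c m a : {morph @kosh c m : z / a *: z}. Proof. by move=> z; rewrite linearZ. Qed.

Lemma kosd_kosd f m (z : kos m) : kosd f (kosd f z) = 0.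
Proof.
elim: m z => [|m IHm] z //; apply: kos_eqP => /=; last first.
  by rewrite kosdN IHm !oppr0.
by rewrite kosdD kosdZ IHm add0r scalerN subrr.
Qed.

(** Contraction is an antiderivation, so its anticommutator with multiplication by a vector is the
    pairing of c with f. Hence every element of the ideal (f) acts as zero on Koszul homology. *)
Lemma kosd_kosh c f m (z : kos m) :
  kosd f (kosh c z) + kosh c (kosd f z) = (\sum_(i < m) c i * f i) *: z.
Proof.
elim: m z => [|m IHm] z; first by rewrite big_ord0 scale0r addr0.
rewrite big_ord_recr; apply: kos_eqP => /=; rewrite scalerDl -IHm.
  by rewrite scalerBr koshD koshZ scalerA addrACA subrK mulrC.
rewrite kosdB kosdZ koshN scalerDr scalerA.
by rewrite opprB opprK -(addrA (c m *: _)) (addrA (_ - _)) subrK (addrC (_ *: _)) addrA.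
Qed.

Lemma kos_hom0 m p : kos_hom p (0 : kos m).
Proof. by elim: m p => [|m IHm] [|p] /=; auto. Qed.
Lemma kos_homD m p (z w : kos m) : kos_hom p z -> kos_hom p w -> kos_hom p (z + w).
Proof.
elim: m p z w => [|m IHm] [|p] z w /=; auto.
- by move=> [//|->] [//|->]; right; rewrite addr0.
- by move=> [z1 ->] [w1 ->]; rewrite addr0; split; auto.
- by move=> [z1 z2] [w1 w2]; split; auto.
Qed.
Lemma kos_homZ m p a (z : kos m) : kos_hom p z -> kos_hom p (a *: z).
Proof.
elim: m p z => [|m IHm] [|p] z /=; auto.
- by move=> [//|->]; right; rewrite scaler0.
- by move=> [z1 ->]; rewrite scaler0; split; auto.
- by move=> [z1 z2]; split; auto.
Qed.
Lemma kos_homN m p (z : kos m) : kos_hom p z -> kos_hom p (- z).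
Proof. by rewrite -scaleN1r; apply: kos_homZ. Qed.
Lemma kos_homB m p (z w : kos m) : kos_hom p z -> kos_hom p w -> kos_hom p (z - w).
Proof. by move=> hz hw; apply: kos_homD => //; apply: kos_homN. Qed.

Lemma kos_hom_big m p (z : kos m) : (m < p)%N -> kos_hom p z -> z = 0.
Proof.
elim: m p z => [|m IHm] [|p] z //=; first by move=> _ [].
by move=> lt [z1 z2]; apply: kos_eqP; [apply: IHm z1; apply: leqW | apply: IHm z2].
Qed.

Lemma kosd_hom0 f m (z : kos m) : kos_hom 0 z -> kosd f z = 0.
Proof.
elim: m z => [|m IHm] z //= [z1 ->].
by apply: kos_eqP; rewrite /= ?kosd0 ?oppr0 // IHm // scaler0 addr0.
Qed.

Lemma kosd_hom f m p (z : kos m) : kos_hom p.+1 z -> kos_hom p (kosd f z).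
Proof.
elim: m p z => [|m IHm] [|p] z /=.
- by left.
- by right.
- move=> [z1 z2]; rewrite (kosd_hom0 f z2) oppr0; split=> //.
  by apply: kos_homD; [apply: IHm | apply: kos_homZ].
- move=> [z1 z2]; split; last by apply/kos_homN/IHm.
  by apply: kos_homD; [apply: IHm | apply: kos_homZ].
Qed.

Lemma kosh_hom c m p (z : kos m) : kos_hom p z -> kos_hom p.+1 (kosh c z).
Proof.
elim: m p z => [|m IHm] p z /=; first by right.
move=> [z1 z2]; split; first exact: IHm.
apply: kos_homB; first exact: kos_homZ.
case: p z1 z2 => [|p] z1 z2; last exact: IHm.
by rewrite z2 kosh0; apply: kos_hom0.
Qed.

Section Membership.
Variable Y : submodClosed R^o.
Lemma kos_in0 m : kos_in Y (0 : kos m).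
Proof. by elim: m => [|m IHm] //=; exact: rpred0. Qed.
Lemma kos_inD m (z w : kos m) : kos_in Y z -> kos_in Y w -> kos_in Y (z + w).
Proof.
elim: m z w => [|m IHm] z w /=; first exact: rpredD.
by move=> [? ?] [? ?]; split; auto.
Qed.
Lemma kos_inZ m a (z : kos m) : kos_in Y z -> kos_in Y (a *: z).
Proof.
elim: m z => [|m IHm] z /=; first exact: rpredZ.
by move=> [? ?]; split; auto.
Qed.
Lemma kos_inN m (z : kos m) : kos_in Y z -> kos_in Y (- z).
Proof. by rewrite -scaleN1r; apply: kos_inZ. Qed.
Lemma kos_inB m (z w : kos m) : kos_in Y z -> kos_in Y w -> kos_in Y (z - w).
Proof. by move=> zY wY; apply: kos_inD => //; apply: kos_inN. Qed.
Lemma kosd_in f m (z : kos m) : kos_in Y z -> kos_in Y (kosd f z).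
Proof.
elim: m z => [|m IHm] z //= => [_|[z1 z2]]; first exact: rpred0.
by split; [apply: kos_inD; [apply: IHm | apply: kos_inZ] | apply/kos_inN/IHm].
Qed.
Lemma kosh_in c m (z : kos m) : kos_in Y z -> kos_in Y (kosh c z).
Proof.
elim: m z => [|m IHm] z //= => [_|[z1 z2]]; first exact: rpred0.
by split; [apply: IHm | apply: kos_inB; [apply: kos_inZ | apply: IHm]].
Qed.
End Membership.

Lemma kos_in_reg Y y m (z : kos m) :
  (forall a : R, y * a \in Y -> a \in Y) -> kos_in Y (y *: z) -> kos_in Y z.
Proof.
move=> reg; elim: m z => [|m IHm] z /=; first exact: reg.
by case; auto.
Qed.

(** Division by y is done coordinate by coordinate. The coordinates outside degree p are zero and
    receive the quotient 0, which keeps v homogeneous. *)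
Lemma kos_in_adjoin Y Y' y m p (z : kos m) :
    (forall a : R, a \in Y' -> exists b, a - y * b \in Y) ->
    kos_in Y' z -> kos_hom p z ->
  exists v, kos_hom p v /\ kos_in Y (z - y *: v).
Proof.
move=> YS; elim: m p z => [|m IHm] p z /=.
  move=> /YS[b zb] [->|z0]; first by exists b; split; [left|].
  by exists 0; split; [right | rewrite z0 scaler0 subr0 rpred0].
move=> [z1 z2] [h1 h2]; have [v1 [hv1 Yv1]] := IHm _ _ z1 h1.
case: p h1 h2 hv1 => [|p] h1 h2 hv1.
  exists (v1, 0); split=> //; split=> //=.
  by rewrite h2 scaler0 subr0; apply: kos_in0.
by have [v2 [hv2 Yv2]] := IHm _ _ z2 h2; exists (v1, v2).
Qed.

(** The standard elements of degrees 0, 1 and m: the unit, the sum of the a_i e_i, and c times the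
    product e_(m-1) ... e_0. *)
Fixpoint kos_unit m : kos m :=
  if m is m'.+1 return kos m then (kos_unit m', 0) else 1.
Fixpoint kos_vec (a : nat -> R) m : kos m :=
  if m is m'.+1 return kos m then (kos_vec a m', a m' *: kos_unit m') else 0.
Fixpoint kos_top (c : R) m : kos m :=
  if m is m'.+1 return kos m then (0, kos_top c m') else c.

Lemma kos_unit_hom m : kos_hom 0 (kos_unit m).
Proof. by elim: m => [|m IHm] /=; auto. Qed.

Lemma kos_unit_eq0 m a : a *: kos_unit m = 0 -> a = 0.
Proof.
by elim: m => [|m IHm] /=; [move=> <-; rewrite /GRing.scale /= mulr1 | case=> /IHm].
Qed.

Lemma kos_unit_in Y m (a : R) : kos_in Y (a *: kos_unit m) -> a \in Y.
Proof.
by elim: m => [|m IHm] /=; [rewrite [a *: _]mulr1 | case=> /IHm].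
Qed.

Lemma kos_vec_hom a m : kos_hom 1 (kos_vec a m).
Proof.
elim: m => [|m IHm] /=; first by right.
by split=> //; apply/kos_homZ/kos_unit_hom.
Qed.

Lemma kosd_vec f a m : kosd f (kos_vec a m) = (\sum_(i < m) a i * f i) *: kos_unit m.
Proof.
elim: m => [|m IHm]; first by rewrite big_ord0 scale0r.
rewrite big_ord_recr; apply: kos_eqP => /=; last first.
  by rewrite kosd_hom0 ?oppr0 ?scaler0 //; apply/kos_homZ/kos_unit_hom.
by rewrite IHm scalerDl scalerA (mulrC (f m)).
Qed.

Lemma kos_hom0E m (z : kos m) : kos_hom 0 z -> exists a, z = a *: kos_unit m.
Proof.
elim: m z => [|m IHm] z /=; first by exists z; rewrite /GRing.scale /= mulr1.
by move=> [/IHm[a za] z2]; exists a; apply: kos_eqP; rewrite //= ?z2 ?scaler0.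
Qed.

Lemma kos_vecE a b m : (forall i, (i < m)%N -> a i = b i) -> kos_vec a m = kos_vec b m.
Proof.
elim: m => [|m IHm] //= ab; rewrite ab // IHm // => i lt; apply: ab; exact: leqW.
Qed.

Lemma kos_hom1E m (z : kos m) : kos_hom 1 z -> exists a, z = kos_vec a m.
Proof.
elim: m z => [|m IHm] z /=; first by case=> // ->; exists (fun=> 0).
move=> [/IHm[a za] /kos_hom0E[b zb]].
exists (fun i => if i == m then b else a i); apply: kos_eqP; rewrite /= ?eqxx //.
by rewrite za; apply: kos_vecE => i lt; rewrite ltn_eqF.
Qed.

Lemma kos_vec_inj a b m : kos_vec a m = kos_vec b m -> forall i, (i < m)%N -> a i = b i.
Proof.
elim: m => [|m IHm] //= [/IHm ab /eqP]; rewrite -subr_eq0 -scalerBl => /eqP/kos_unit_eq0/eqP.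
by rewrite subr_eq0 => /eqP abm i; rewrite ltnS leq_eqVlt => /orP[/eqP->|/ab].
Qed.

Lemma kos_homnE m (z : kos m) : kos_hom m z -> exists a, z = kos_top a m.
Proof.
elim: m z => [|m IHm] z /=; first by exists z.
move=> [/kos_hom_big-/(_ (ltnSn m)) z1 /IHm[c zc]].
by exists c; apply: kos_eqP.
Qed.

Lemma kos_topD a b m : kos_top (a + b) m = kos_top a m + kos_top b m.
Proof. by elim: m => [|m IHm] //=; apply: kos_eqP; rewrite /= ?addr0. Qed.
Lemma kos_topZ a b m : kos_top (a * b) m = a *: kos_top b m.
Proof. by elim: m => [|m IHm] //=; apply: kos_eqP; rewrite /= ?scaler0. Qed.
Lemma kos_top_hom (c : R) m : kos_hom m (kos_top c m).
Proof. by elim: m => [|m IHm] /=; [left | split=> //; apply: kos_hom0]. Qed.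
Lemma kos_top_in Y (c : R) m : kos_in Y (kos_top c m) <-> c \in Y.
Proof.
elim: m => [|m IHm] //=; split=> [[_ /IHm]|cY] //.
by split; [apply: kos_in0 | apply/IHm].
Qed.
(** Up to sign, the nonzero coordinates of the differential of a top element are among the products
    f_i c. *)
Lemma kosd_top_in Y f (c : R) m :
  kos_in Y (kosd f (kos_top c m)) <-> forall i, (i < m)%N -> f i * c \in Y.
Proof.
elim: m => [|m IHm] /=; first by split=> // _; exact: rpred0.
rewrite kosd0 add0r -kos_topZ; split.
  move=> [/kos_top_in fcY /kos_inN]; rewrite opprK => /IHm cY i.
  by rewrite ltnS leq_eqVlt => /orP[/eqP->|/cY].
move=> cY; split; first by apply/kos_top_in/cY.
by apply/kos_inN/IHm => i lt; apply/cY/leqW.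
Qed.

(* Antisymmetry of the Koszul relations, tested against a symmetric bilinear
   map instead of written out as an antisymmetric matrix. *)
Lemma kosd_hom2_sym f (M S : lmodType R) (psi : {linear M -> R^o})
    (e : nat -> M) (B : M -> M -> S) m (w : kos m) :
    (forall i, psi (e i) = f i) ->
    (forall z, linear (B^~ z)) -> (forall x y, B x y = B y x) ->
    kos_hom 2 w ->
  exists A : nat -> M, kosd f w = kos_vec (fun i => psi (A i)) m
    /\ \sum_(i < m) B (A i) (e i) = 0.
Proof.
move=> psie linB symB.
have BD x y z : B (x + y) z = B x z + B y z.
  by have := linB z 1 x y; rewrite !scale1r.
have B0 z : B 0 z = 0 by apply: (addrI (B 0 z)); rewrite -BD !addr0.
have BZ a x z : B (a *: x) z = a *: B x z.
  by have := linB z a x 0; rewrite !addr0 B0 addr0.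
elim: m w => [|m IHm] w /=.
  by move=> _; exists (fun=> 0); rewrite big_ord0.
move=> [/IHm[A [dw1 sA]] /kos_hom1E[b w2]].
(* For w = w_1 + e_m w_2 with w_2 of coordinates b_i, the differential is d w_1 + f_m w_2 - e_m d
   w_2. The lifts through [psi] replace each f_j by [e j]; the new terms b_i B(e_m, e_i) and - b_i
   B(e_i, e_m) then cancel by symmetry. *)
exists (fun i => if i == m then - \sum_(j < m) b j *: e j else A i + b i *: e m).
split.
  apply: kos_eqP => /=.
    rewrite dw1 w2; have H a (c : R) q : kos_vec a q + c *: kos_vec b q = kos_vec (fun i => a i + c * b i) q.
      elim: q => [|q IHq] /=; first by rewrite scaler0 addr0.
      by apply: kos_eqP; rewrite /= ?IHq // scalerDl scalerA.
    rewrite H; apply: kos_vecE => i lt; rewrite (ltn_eqF lt) linearD linearZ /= psie.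
    by rewrite mulrC.
  rewrite eqxx w2 kosd_vec linearN linear_sum /= scaleNr; congr (- (_ *: _)).
  by apply: eq_bigr => i _; rewrite linearZ /= psie.
rewrite big_ord_recr /= eqxx.
under eq_bigr => i _ do rewrite (ltn_eqF (ltn_ord i)) BD BZ.
rewrite big_split /= sA add0r -scaleN1r BZ scaleN1r.
have -> : B (\sum_(j < m) b j *: e j) (e m) = \sum_(j < m) b j *: B (e j) (e m).
  rewrite (big_morph (B^~ (e m)) (fun x y => BD x y _) (B0 _)).
  by apply: eq_bigr => i _; rewrite BZ.
under eq_bigr => i _ do rewrite symB.
by rewrite subrr.
Qed.

(** * Koszul homology and a regular sequence y_0, ..., y_(n-1) in (f), with Y r = (y_0, ...,
    y_(r-1)) *)

Section DepthSensitivity.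
Variables (n : nat) (f : nat -> R) (Y : nat -> submodClosed R^o).
Variables (y : nat -> R) (c : nat -> nat -> R).
Hypothesis yE : forall r, (r < n)%N -> y r = \sum_(i < n) c r i * f i.
Hypothesis Y0 : forall a : R, a \in Y 0 -> a = 0.
Hypothesis YS : forall r (a : R), (r < n)%N -> a \in Y r.+1 <-> exists b, a - y r * b \in Y r.
Hypothesis Yreg : forall r (a : R), (r < n)%N -> y r * a \in Y r -> a \in Y r.

Lemma kos_inS r m (z : kos m) : (r < n)%N -> kos_in (Y r) z -> kos_in (Y r.+1) z.
Proof.
move=> rn; elim: m z => [|m IHm] z /=; last by case; auto.
by move=> zY; apply/YS => //; exists 0; rewrite mulr0 subr0.
Qed.
Lemma kos_inyZ r m (z : kos m) : (r < n)%N -> kos_in (Y r.+1) (y r *: z).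
Proof.
move=> rn; elim: m z => [|m IHm] z /=; last by auto.
by apply/YS => //; exists z; rewrite subrr; exact: rpred0.
Qed.

Lemma kosd_koshy r (z : kos n) : (r < n)%N ->
  kosd f (kosh (c r) z) = y r *: z - kosh (c r) (kosd f z).
Proof. by move=> rn; rewrite yE // -kosd_kosh addrK. Qed.

(* Depth sensitivity of the Koszul complex: y r lies in (f_0, ..., f_(n-1)),
   hence kills the homology, so that H_(p+1)(f; R/Y_(r+1)) maps onto
   H_p(f; R/Y_r). *)
Lemma koszul_acyclic r p (z : kos n) : (r <= n)%N -> (r < p)%N ->
    kos_hom p z -> kos_in (Y r) (kosd f z) ->
  exists w, kos_hom p.+1 w /\ kos_in (Y r) (z - kosd f w).
Proof.
move=> /subnKC; move: (n - r)%N => s.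
(* Descending induction on r, as induction on n - r. At r = n the degree p exceeds n, so z = 0. *)
elim: s r p z => [|s IHs] r p z.
  rewrite addn0 => -> np hz _; exists 0; split; first exact: kos_hom0.
  by rewrite kosd0 (kos_hom_big np hz) subrr; apply: kos_in0.
rewrite addnS -addSn => /[dup] rsn /IHs{}IHs rp hz dz.
have rn : (r < n)%N by rewrite -rsn leq_addr.
set u := kosh (c r) z.
have du : kosd f u = y r *: z - kosh (c r) (kosd f z) by exact: kosd_koshy.
(* The product u is a cycle modulo Y_(r+1), hence a boundary d w there. Writing u - d w = y_r v
   modulo Y_r and differentiating puts y_r (z - d v) in Y_r, and y_r cancels. *)
have [||w [hw uw]] := IHs p.+1 u rp; first exact: kosh_hom.
  by rewrite du; apply: kos_inB; [apply: kos_inyZ | apply/kos_inS/kosh_in].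
have hudw : kos_hom p.+1 (u - kosd f w).
  by apply: kos_homB; [apply: kosh_hom | apply: kosd_hom].
have [v [hv tY]] := kos_in_adjoin (fun a => (YS a rn).1) uw hudw.
exists v; split=> //; apply: (kos_in_reg (fun a => @Yreg r a rn)).
have := kosd_in f tY; rewrite !kosdB kosdZ kosd_kosd subr0 du => dtY.
have -> : y r *: (z - kosd f v) =
    y r *: z - kosh (c r) (kosd f z) - y r *: kosd f v + kosh (c r) (kosd f z).
  by rewrite scalerBr addrAC subrK.
by apply: kos_inD => //; apply: kosh_in.
Qed.

(** Acyclicity at r = 0 and p = 1: since Y_0 is zero, the congruence modulo Y_0 is an equality. *)
Lemma koszul_H1 (z : kos n) : kos_hom 1 z -> kosd f z = 0 ->
  exists2 w, kos_hom 2 w & z = kosd f w.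
Proof.
move=> hz dz; have [|w [hw zw]] := @koszul_acyclic 0 1 z (leq0n _) isT hz.
  by rewrite dz; apply: kos_in0.
exists w => //; apply/eqP; rewrite -subr_eq0; apply/eqP.
move: (z - _) zw => t; elim: (n) t => [|m IHm] t /=; first exact: Y0.
by move=> [/IHm t1 /IHm t2]; apply: kos_eqP.
Qed.

(* The classes H_r(f; R/Y_r) are all isomorphic to H_0(f; R) = R/(f). *)
Lemma koszul_shift r : (r <= n)%N -> exists w : kos n,
  [/\ kos_hom r w, kos_in (Y r) (kosd f w),
      forall b s, kos_hom r.+1 s -> kos_in (Y r) (b *: w - kosd f s) ->
        exists a, b = \sum_(i < n) a i * f i
    & forall z, kos_hom r z -> kos_in (Y r) (kosd f z) ->
        exists b s, kos_hom r.+1 s /\ kos_in (Y r) (z - b *: w - kosd f s)].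
Proof.
elim: r => [|r IHr] rn.
  exists (kos_unit n); split.
  - exact: kos_unit_hom.
  - by rewrite (kosd_hom0 _ (kos_unit_hom n)); apply: kos_in0.
  - move=> b s /kos_hom1E[a ->]; rewrite kosd_vec -scalerBl => bY.
    have /eqP : b - \sum_(i < n) a i * f i = 0.
      exact/Y0/(kos_unit_in bY).
    by rewrite subr_eq0 => /eqP->; exists a.
  - move=> z /kos_hom0E[b ->] _; exists b, 0; split; first exact: kos_hom0.
    by rewrite subrr kosd0 subr0; apply: kos_in0.
have [w [hw dw inj sur]] := IHr (ltnW rn).
have YSr a := (YS a rn).1.
have reg := kos_in_reg (fun a => @Yreg r a rn).
(* The generator at level r + 1 is the previous one multiplied by the vector c_r, which raises its
   degree by one. *)
exists (kosh (c r) w); split.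
- exact: kosh_hom.
- rewrite kosd_koshy //.
  by apply: kos_inB; [apply: kos_inyZ | apply/kos_inS/kosh_in].
- move=> b s hs tY.
  have ht : kos_hom r.+1 (b *: kosh (c r) w - kosd f s).
    by apply: kos_homB; [apply/kos_homZ/kosh_hom | apply: kosd_hom].
  (* The relation is y_r v modulo Y_r; differentiating puts y_r (b w - d v) in Y_r, and the previous
     level applies once y_r is cancelled. *)
  have [v [hv tv]] := kos_in_adjoin YSr tY ht.
  apply: (inj b v) => //; apply: reg.
  have := kosd_in f tv; rewrite !kosdB !kosdZ kosd_kosd subr0 kosd_koshy // => dtv.
  have -> : y r *: (b *: w - kosd f v) = b *: (y r *: w - kosh (c r) (kosd f w))
      - y r *: kosd f v + b *: kosh (c r) (kosd f w).
    by rewrite !scalerBr [RHS]addrAC subrK !scalerA (mulrC b).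
  by apply: kos_inD => //; apply/kos_inZ/kosh_in.
- move=> z hz dz; have hdz := kosd_hom f hz.
  have [z' [hz' tY]] := kos_in_adjoin YSr dz hdz.
  have dz' : kos_in (Y r) (kosd f z').
    apply: reg; have := kosd_in f tY; rewrite kosdB kosdZ kosd_kosd sub0r.
    by move=> /kos_inN; rewrite opprK.
  have [b [s [hs tY']]] := sur _ hz' dz'.
  (* If d z = y_r z' and z' = b w + d s modulo Y_r, then u is a cycle modulo Y_r of degree above r,
     hence a boundary there. The term y_r s vanishes modulo Y_(r+1). *)
  pose u := z - b *: kosh (c r) w - y r *: s.
  have hu : kos_hom r.+1 u.
    by do !apply: kos_homB => //; do !apply: kos_homZ => //; apply: kosh_hom.
  have du : kos_in (Y r) (kosd f u).
    have -> : kosd f u = (kosd f z - y r *: z') + y r *: (z' - b *: w - kosd f s)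
        + b *: kosh (c r) (kosd f w).
      rewrite /u !kosdB !kosdZ kosd_koshy //.
      rewrite !scalerBr !scalerA (mulrC b) !addrA subrK opprB !addrA.
      by rewrite [RHS]addrAC; congr (_ - _); rewrite addrAC.
    by apply: kos_inD; [apply: kos_inD | apply/kos_inZ/kosh_in] => //; apply: kos_inZ.
  have [v [hv uv]] := koszul_acyclic (ltnW rn) (ltnSn r) hu du.
  exists b, v; split=> //.
  have -> : z - b *: kosh (c r) w - kosd f v = (u - kosd f v) + y r *: s.
    by rewrite /u [RHS]addrAC subrK.
  by apply: kos_inD; [apply: kos_inS | apply: kos_inyZ].
Qed.

(** The shift at r = n. An element of degree n is a single coefficient and degree n + 1 is zero, so
    the cycles modulo Y_n form the ideal Y_n : (f). Thus (Y_n : (f))/Y_n is cyclic on w, with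
    annihilator (f). *)
Lemma colon_cyclic : exists w : R,
  [/\ forall i, (i < n)%N -> f i * w \in Y n,
      forall b, b * w \in Y n -> exists a, b = \sum_(i < n) a i * f i
    & forall z, (forall i, (i < n)%N -> f i * z \in Y n) ->
        exists b, z - b * w \in Y n].
Proof.
have [_ [/kos_homnE[w ->] /kosd_top_in dw inj sur]] := koszul_shift (leqnn n).
exists w; split=> //.
  move=> b bw; apply: (inj b 0); first exact: kos_hom0.
  by rewrite kosd0 subr0 -kos_topZ; apply/kos_top_in.
move=> z fz; have [|b [s [hs]]] := sur _ (kos_top_hom z n); first exact/kosd_top_in.
rewrite (kos_hom_big (ltnSn n) hs) kosd0 subr0 -kos_topZ -scaleN1r -kos_topZ -kos_topD.
by move=> /kos_top_in zbw; exists b; rewrite -mulN1r.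
Qed.

End DepthSensitivity.
End KoszulComplex.

(** * Coefficients, monomials, partial derivatives and monomial ideals of power series *)

Section PowerSeries.
Variables (n : nat) (k : comNzRingType).
Local Notation R := (fps n k).
Implicit Types (f g h : R) (m a b : 'X_{1..n}).

Lemma fpsDE f g m : (f + g) m = f m + g m. Proof. by []. Qed.
Lemma fpsNE f m : (- f) m = - f m. Proof. by []. Qed.
Lemma fpsBE f g m : (f - g) m = f m - g m. Proof. by []. Qed.
Lemma fps0E m : (0 : R) m = 0. Proof. exact: if_same. Qed.

Lemma fps_sumE (I : Type) (r : seq I) (P : pred I) (F : I -> R) m :
  (\sum_(i <- r | P i) F i) m = \sum_(i <- r | P i) F i m.
Proof.
exact: (big_morph (fun f : R => f m) (fun f g => fpsDE f g m) (fps0E m)).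
Qed.

Lemma fps_mul_eq0 f g m :
  (forall a b, m = (a + b)%MM -> f a * g b = 0) -> (f * g) m = 0.
Proof. by move=> fg0; rewrite /= big1 // => -[a b] /= /eqP/fg0. Qed.

Lemma fpsC_is_zmod_morphism : zmod_morphism (@fpsC n k).
Proof.
by move=> c d; apply: fpsP => m; rewrite fpsBE /=; case: eqP; rewrite ?subr0.
Qed.

Lemma fpsCME c f m : (fpsC n c * f) m = c * f m.
Proof.
rewrite -[LHS]/(fps_mul _ _ m) (fps_mulE (p := c%:MP) (q := fps_trunc (mdeg m).+1 f)).
- by rewrite mcoeffCM fps_truncE.
- by move=> a _; rewrite mcoeffC /=; case: eqP; rewrite ?mulr1 ?mulr0.
- by move=> a le; rewrite fps_truncE.
Qed.

Lemma fpsC_is_monoid_morphism : monoid_morphism (@fpsC n k).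
Proof.
split=> // c d; apply: fpsP => m; rewrite fpsCME /=.
by case: eqP; rewrite ?mulr0.
Qed.

HB.instance Definition _ :=
  GRing.isZmodMorphism.Build k R (@fpsC n k) fpsC_is_zmod_morphism.
HB.instance Definition _ :=
  GRing.isMonoidMorphism.Build k R (@fpsC n k) fpsC_is_monoid_morphism.

Definition fpsM a : R := Fps (fun m => (m == a)%:R).

Lemma fpsMME a g m : (fpsM a * g) m = if (a <= m)%MM then g (m - a)%MM else 0.
Proof.
case: ifPn => [am | Nam]; last first.
  apply: fps_mul_eq0 => b c mE /=; case: eqP => [ba|]; last by rewrite mul0r.
  by case/negP: Nam; rewrite mE ba lem_addr.
rewrite -[LHS]/(fps_mul _ _ m) (fps_mulE (p := 'X_[a]) (q := fps_trunc (mdeg m).+1 g)).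
- rewrite mulrC -[X in _@_X](submK am) addmC mcoeffMX fps_truncE //.
  by rewrite ltnS -[X in (_ <= mdeg X)%N](submK am) mdegD leq_addr.
- by move=> b _; rewrite mcoeffX eq_sym.
- by move=> b le; rewrite fps_truncE.
Qed.

Lemma fpsM_shift a g m : (fpsM a * g) (a + m)%MM = g m.
Proof. by rewrite fpsMME lem_addr addmC addmK. Qed.

Lemma fpsXE i : fpsX k i = fpsM U_(i). Proof. by []. Qed.
Lemma fpsM0 : fpsM 0%MM = 1.
Proof. by apply: fpsP => m /=; case: eqP. Qed.

Lemma fpsMM a b : fpsM a * fpsM b = fpsM (a + b).
Proof.
apply: fpsP => m; rewrite fpsMME /=; case: ifPn => [am|Nam].
  by rewrite -[X in _ = (X == _)%:R](submK am) addmC (inj_eq (@addmI _ a)).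
by case: eqP => // mE; case/negP: Nam; rewrite mE lem_addr.
Qed.

Lemma fpsXn i e : fpsX k i ^+ e = fpsM (U_(i) *+ e)%MM.
Proof.
elim: e => [|e IHe]; first by rewrite expr0 -fpsM0 mulm0n.
by rewrite exprS IHe fpsXE fpsMM mulmS.
Qed.

Lemma fpsXnME i e g m :
  (fpsX k i ^+ e * g) m = if (e <= m i)%N then g (m - U_(i) *+ e)%MM else 0.
Proof.
rewrite fpsXn fpsMME; congr (if _ then _ else _); apply/mnm_lepP/idP => [/(_ i)|le j].
  by rewrite mulmnE mnm1E eqxx mul1n.
by rewrite mulmnE mnm1E; case: eqP => [<-|_]; rewrite ?mul1n ?mul0n.
Qed.

Lemma fps_cstM f g : (f * g) 0%MM = f 0%MM * g 0%MM.
Proof.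
have mdeg0 (a : 'X_{1..n}) : (mdeg a <= mdeg (0%MM : 'X_{1..n}))%N -> a = 0%MM.
  by rewrite mdeg0 leqn0 mdeg_eq0 => /eqP.
rewrite -[LHS]/(fps_mul _ _ _) (fps_mulE (p := (f 0%MM)%:MP) (q := (g 0%MM)%:MP)).
- by rewrite -mpolyCM mcoeffC eqxx mulr1.
- by move=> a /mdeg0->; rewrite mcoeffC eqxx mulr1.
- by move=> a /mdeg0->; rewrite mcoeffC eqxx mulr1.
Qed.

Lemma fps_derivD i f g : fps_deriv i (f + g) = fps_deriv i f + fps_deriv i g.
Proof. by apply: fpsP => m; rewrite /= mulrnDl. Qed.
Lemma fps_deriv0 i : fps_deriv i 0 = 0 :> R.
Proof. by apply: fpsP => m; rewrite /= !if_same mul0rn. Qed.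
Lemma fps_deriv_sum i (I : Type) (r : seq I) (P : pred I) (F : I -> R) :
  fps_deriv i (\sum_(j <- r | P j) F j) = \sum_(j <- r | P j) fps_deriv i (F j).
Proof. exact: (big_morph _ (fps_derivD i) (fps_deriv0 i)). Qed.

Lemma fps_derivM i f g :
  fps_deriv i (f * g) = fps_deriv i f * g + f * fps_deriv i g.
Proof.
apply: fpsP => m.
(* A coefficient of a derivative reads one degree higher, so the truncation keeps all degrees up to
   [mdeg m] + 1. *)
pose p := fps_trunc (mdeg m).+2 f; pose q := fps_trunc (mdeg m).+2 g.
have trE h a : (mdeg a <= (mdeg m).+1)%N -> (fps_trunc (mdeg m).+2 h)@_a = h a.
  by move=> le; rewrite fps_truncE.
have trdE h a : (mdeg a <= mdeg m)%N ->
    (fps_trunc (mdeg m).+2 h)^`M(i)@_a = fps_deriv i h a.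
  by move=> le; rewrite mcoeff_deriv trE // mdegD mdeg1 addn1 ltnS.
have -> : fps_deriv i (f * g) m = (p * q)^`M(i)@_m.
  rewrite mcoeff_deriv; congr (_ *+ _).
  by apply: fps_mulE => a; rewrite mdegD mdeg1 addn1; apply: trE.
rewrite mderivM mcoeffD fpsDE.
by congr (_ + _); apply/esym/fps_mulE => a le; rewrite ?trdE // trE // leqW.
Qed.

Lemma fps_derivC i j f : fps_deriv i (fps_deriv j f) = fps_deriv j (fps_deriv i f).
Proof.
apply: fpsP => m; rewrite /= -!mulrnA -!addmA (addmC U_(i)%MM).
by congr (_ *+ _); rewrite !mnmDE !mnm1E; case: (eqVneq i j) => [->|] //=; rewrite !addn0 mulnC.
Qed.

Lemma fps_derivX (i j : 'I_n) : fps_deriv i (fpsX k j) = (i == j)%:R :> R.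
Proof.
case: (eqVneq i j) => [->|Nij]; apply: fpsP => m; last first.
  rewrite fps0E /=; case: eqP => [/mnmP/(_ i)|]; last by rewrite mul0rn.
  by rewrite mnmDE !mnm1E eqxx eq_sym (negPf Nij) addn1.
rewrite /=; have -> : (m + U_(j) == U_(j))%MM = (m == 0%MM).
  by rewrite -{2}[U_(j)%MM]add0m eqm_add2r.
by case: eqP => [->|]; rewrite ?mul0rn //= mnm0E.
Qed.

Lemma fps_derivXn i f e : fps_deriv i (f ^+ e) = (e%:R * f ^+ e.-1) * fps_deriv i f.
Proof.
elim: e => [|e IHe].
  rewrite mulr0n !mul0r expr0.
  by have := fps_derivM i 1 1; rewrite !mul1r mulr1 -[LHS]addr0 => /addrI <-.
rewrite exprS fps_derivM IHe /= mulrC -natr1 !mulrDl mul1r addrC; congr (_ + _).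
by case: e {IHe} => [|e]; rewrite ?mul0r ?mulr0 //= exprS !mulrA (mulrC f).
Qed.

Section Truncation.
Variable N : nat.

Definition small_upto (r : nat) m := forall i : 'I_n, (i < r)%N -> (m i < N)%N.

(* The ideal generated by the N-th powers of the first r variables. *)
Definition mon_ideal r : {pred R^o} :=
  [pred f : R | `[< forall m, small_upto r m -> f m = 0 >]].

Lemma mon_idealP r f :
  reflect (forall m, small_upto r m -> f m = 0) (f \in mon_ideal r).
Proof. exact: asboolP. Qed.

Lemma mon_ideal_closed r : subsemimod_closed (mon_ideal r).
Proof.
split; first split.
- by apply/mon_idealP => m _; exact: fps0E.
- move=> f g /mon_idealP f0 /mon_idealP g0; apply/mon_idealP => m sm.
  by rewrite fpsDE f0 // g0 // addr0.
- move=> h f /mon_idealP f0; apply/mon_idealP => m sm.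
  apply: fps_mul_eq0 => a b mE; rewrite f0 ?mulr0 // => i /sm.
  by rewrite mE mnmDE; apply: leq_ltn_trans (leq_addl _ _).
Qed.
HB.instance Definition _ r :=
  GRing.isSubSemiModClosed.Build R R^o (mon_ideal r) (mon_ideal_closed r).

Lemma mon_ideal0 f : f \in mon_ideal 0 -> f = 0.
Proof. by move=> /mon_idealP f0; apply: fpsP => m; rewrite f0 // fps0E. Qed.

Lemma mon_idealS (i : 'I_n) f :
  f \in mon_ideal i.+1 <-> exists g, f - fpsX k i ^+ N * g \in mon_ideal i.
Proof.
split=> [/mon_idealP f0 | [g /mon_idealP fg0]].
  (* The quotient collects the terms divisible by the N-th power of variable i and shifts them
     down. *)
  exists (Fps (fun m => f (m + U_(i) *+ N)%MM)); apply/mon_idealP => m sm.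
  rewrite fpsBE fpsXnME; case: leqP => [le|lt].
    rewrite /= submK ?subrr //; apply/mnm_lepP => j.
    by rewrite mulmnE mnm1E; case: eqP => [<-|_]; rewrite ?mul1n ?mul0n.
  rewrite subr0; apply: f0 => j; rewrite ltnS leq_eqVlt => /orP[/eqP/val_inj->//|].
  exact: sm.
apply/mon_idealP => m sm; have := fg0 m; rewrite fpsBE fpsXnME leqNgt (sm i) //=.
by rewrite subr0; apply=> j lt; apply/sm/ltnW.
Qed.

(** Membership at index i constrains only the exponents of earlier variables, so shifting the
    exponent of variable i does not disturb it. The N-th powers are therefore a regular sequence. *)
Lemma mon_ideal_reg (i : 'I_n) f : fpsX k i ^+ N * f \in mon_ideal i -> f \in mon_ideal i.
Proof.
move=> /mon_idealP xf0; apply/mon_idealP => m sm.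
have := xf0 (U_(i) *+ N + m)%MM; rewrite fpsXn fpsM_shift; apply=> j lt.
rewrite mnmDE mulmnE mnm1E; case: eqP lt => [<-|_ lt]; first by rewrite ltnn.
by rewrite mul0n add0n sm.
Qed.

Lemma mon_ideal_sub (L : submodClosed R^o) :
  (forall i, fpsX k i ^+ N \in L) -> {subset mon_ideal n <= L}.
Proof.
move=> XL; suff main r : (r <= n)%N -> {subset mon_ideal r <= L} by exact: main.
elim: r => [|r IHr] rn f; first by move/mon_ideal0->; exact: rpred0.
move=> /(mon_idealS (Ordinal rn))[g /(IHr (ltnW rn)) fgL].
rewrite -(subrK (fpsX k (Ordinal rn) ^+ N * g) f); apply: (rpredD fgL).
by rewrite mulrC; apply: (rpredZ g); apply: XL.
Qed.

End Truncation.


(** With N = 1 and all variables, the monomial ideal is the maximal ideal. *)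
Lemma mon_ideal1P f : reflect (f 0%MM = 0) (f \in mon_ideal 1 n).
Proof.
apply: (iffP (mon_idealP _ _ _)) => [|f0 m sm]; first by apply=> i; rewrite mnm0E.
rewrite (_ : m = 0%MM) //; apply/mnmP => i.
by have := sm i (ltn_ord i); rewrite mnm0E; case: (m i).
Qed.

End PowerSeries.

(** * Generated submodules, adjunction of a vector, and colon ideals *)

Section Submodules.
Variables (R : comNzRingType) (M : lmodType R).
Implicit Types (S T : M -> Prop) (L : submodClosed M).

Lemma span_gen S x : S x -> x \in span S.
Proof.
move=> Sx; apply/asboolP; exists 1%N, (fun=> 1), (fun=> x).
by split=> //; rewrite big_ord1 scale1r.
Qed.

Lemma span_ind S (P : M -> Prop) : P 0 -> (forall x y, P x -> P y -> P (x + y)) ->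
  (forall a x, S x -> P (a *: x)) -> forall x, x \in span S -> P x.
Proof.
move=> P0 PD PZ _ /asboolP[r [c [v [Sv ->]]]].
by apply: (big_ind P) => // i _; apply/PZ/Sv.
Qed.

Lemma span_sub S L : (forall x, S x -> x \in L) -> {subset span S <= L}.
Proof.
move=> SL; apply: span_ind; [exact: rpred0 | exact: rpredD |].
by move=> a x /SL; exact: rpredZ.
Qed.

Lemma submodN L : {in L, forall x, - x \in L}.
Proof. by move=> x xL; rewrite -scaleN1r rpredZ. Qed.
Lemma submodB L : {in L &, forall x y, x - y \in L}.
Proof. by move=> x y xL yL; rewrite rpredD // submodN. Qed.

Definition adjoin L v : submodClosed M := span (fun x => x \in L \/ x = v).

Lemma adjoin_sub L v : {subset L <= adjoin L v}.
Proof. by move=> x Lx; apply: span_gen; left. Qed.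
Lemma adjoin_mem L v : v \in adjoin L v.
Proof. by apply: span_gen; right. Qed.
Lemma adjoin_min L L' v : {subset L <= L'} -> v \in L' -> {subset adjoin L v <= L'}.
Proof. by move=> LL' vL'; apply: span_sub => x [/LL'|->]. Qed.

Definition colon L (v : M) : {pred R^o} := [pred a : R | a *: v \in L].

Lemma colon_closed L v : subsemimod_closed (colon L v).
Proof.
split; first split.
- by rewrite inE scale0r rpred0.
- by move=> a b; rewrite !inE scalerDl; exact: rpredD.
- by move=> a b; rewrite !inE -scalerA; exact: rpredZ.
Qed.
HB.instance Definition _ L v :=
  GRing.isSubSemiModClosed.Build R R^o (colon L v) (colon_closed L v).

Lemma colonE L v a : (a \in colon L v) = (a *: v \in L). Proof. by []. Qed.

Definition fullmod : submodClosed M := span (fun=> True).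
Lemma in_fullmod x : x \in fullmod. Proof. exact: span_gen. Qed.

Definition zeromod : submodClosed M := span (fun=> False).
Lemma zeromodE x : (x \in zeromod) = (x == 0).
Proof.
apply/idP/eqP => [|->]; last exact: rpred0.
by move: x; apply: span_ind => // x y -> ->; rewrite addr0.
Qed.

End Submodules.

(** * Composition series, length and dimension over k *)

Section CompositionSeries.
Variables (n : nat) (k : fieldType).
Local Notation R := (fps n k).
Local Notation "c %:S" := (fpsC n (c : k)) (at level 2, format "c %:S").

Section OneModule.
Variable M : lmodType R.
Implicit Types (L N P : submodClosed M) (v x : M) (vs : seq M).

Lemma maximal_kill L v (a : R) :
  (forall i, fpsX k i *: v \in L) -> a 0%MM = 0 -> a *: v \in L.
Proof.
move=> Xv /mon_ideal1P a0; rewrite -colonE; move: a a0; apply: mon_ideal_sub.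
by move=> i; rewrite expr1 colonE.
Qed.

(** R is the sum of k and its maximal ideal, and the latter sends v into L; adjoining v therefore
    adds only the line k v. *)
Lemma adjoinP L v x : (forall i, fpsX k i *: v \in L) ->
  x \in adjoin L v <-> exists c, x - c%:S *: v \in L.
Proof.
move=> Xv; split=> [|[c xcv]]; last first.
  rewrite -(subrK (c%:S *: v) x) rpredD //; first exact: adjoin_sub.
  by rewrite rpredZ ?adjoin_mem.
move: x; apply: span_ind.
- by exists 0; rewrite rmorph0 scale0r subr0 rpred0.
- move=> x y [c xL] [d yL]; exists (c + d).
  by rewrite rmorphD scalerDl opprD addrACA rpredD.
move=> a x [xL|->]; first by exists 0; rewrite rmorph0 scale0r subr0 rpredZ.
exists (a 0%MM); rewrite -scalerBl; apply: maximal_kill => //.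
by rewrite fpsBE /= eqxx subrr.
Qed.

(* vs lists the vectors to be adjoined to L, one simple quotient at a time, in
   order to reach N. *)
Fixpoint comp_series L vs N : Prop :=
  if vs is v :: vs' then
    [/\ v \notin L, forall i, fpsX k i *: v \in L & comp_series (adjoin L v) vs' N]
  else L =i N.

Lemma comp_sub L vs N : comp_series L vs N -> {subset L <= N}.
Proof.
elim: vs L => [|v vs IHvs] L /=; first by move=> LN x; rewrite LN.
by move=> [_ _ /IHvs LN] x /(@adjoin_sub _ _ _ v)/LN.
Qed.

Lemma comp_eql L L' vs N : L =i L' -> comp_series L vs N -> comp_series L' vs N.
Proof.
elim: vs L L' => [|v vs IHvs] L L' LL' /=; first by move=> LN x; rewrite -LL'.
move=> [vL Xv cN]; split; rewrite -?LL' //; first by move=> i; rewrite -LL'.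
apply: IHvs cN => x; apply/idP/idP; apply: span_sub => y.
  by move=> [yL|->]; apply: span_gen; [left; rewrite -LL' | right].
by move=> [yL|->]; apply: span_gen; [left; rewrite LL' | right].
Qed.

Lemma comp_cat L vs N ws P : comp_series L vs N -> comp_series N ws P -> comp_series L (vs ++ ws) P.
Proof.
elim: vs L => [|v vs IHvs] L /=; first by move=> LN; apply: comp_eql.
by move=> [vL Xv /IHvs cP] /cP.
Qed.

(** The series is intersected with N. If a step adjoining v brings in a new element u of N, then u =
    c v modulo L with c nonzero and u replaces v; otherwise the step leaves the intersection
    unchanged and is dropped. *)
Lemma comp_restrict L vs P N L' : comp_series L vs P -> {subset N <= P} ->
    (forall x, (x \in L') = (x \in L) && (x \in N)) ->
  exists ws, comp_series L' ws N.
Proof.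
move=> + NP; elim: vs L L' => [|v vs IHvs] L L' /=.
  move=> LP L'E; exists [::] => x; rewrite L'E LP.
  by apply/andP/idP => [[]|xN] //; rewrite NP.
move=> [vL Xv cP] L'E.
have [[u [uN uLv uL]]|no_u] :=
    pselect (exists u, [/\ u \in N, u \in adjoin L v & u \notin L]).
  have L'N x : x \in L' -> x \in N by rewrite L'E => /andP[].
  have [c ucv] := (adjoinP _ Xv).1 uLv.
  have c0 : c != 0.
    by apply: contraNneq uL => c0; move: ucv; rewrite c0 rmorph0 scale0r subr0.
  have XuL i : fpsX k i *: u \in L.
    rewrite -(subrK (c%:S *: v) u) scalerDr; apply: rpredD.
      exact: rpredZ.
    by rewrite scalerA mulrC -scalerA; apply/rpredZ/Xv.
  have Xu i : fpsX k i *: u \in L' by rewrite L'E XuL rpredZ.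
  have [ws cN] : exists ws, comp_series (adjoin L' u) ws N.
    apply: IHvs cP _ => x; apply/idP/andP => [/(adjoinP _ Xu)[d]|[xLv xN]].
      rewrite L'E => /andP[xduL xduN]; rewrite -(subrK (d%:S *: u) x).
      split; last by rewrite rpredD // rpredZ.
      by rewrite rpredD // ?rpredZ //; apply: adjoin_sub.
    have [d xdv] := (adjoinP _ Xv).1 xLv; apply/(adjoinP _ Xu).
    exists (d / c); rewrite L'E; apply/andP; split; last first.
      by apply: submodB => //; apply: rpredZ.
    have -> : x - (d / c)%:S *: u = x - d%:S *: v - (d / c)%:S *: (u - c%:S *: v).
      by rewrite scalerBr scalerA -rmorphM divfK // opprB addrA subrK.
    by rewrite submodB // rpredZ.
  exists (u :: ws); split=> //; by rewrite L'E negb_and uL.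
apply: IHvs cP _ => x; rewrite L'E; apply/andP/andP => -[xL xN]; split=> //.
  exact: adjoin_sub.
by apply: contrapT => /negP xL'; apply: no_u; exists x.
Qed.

Lemma comp_coord L vs N x : comp_series L vs N -> x \in N ->
  exists c : nat -> k, x - \sum_(i < size vs) (c i)%:S *: vs`_i \in L.
Proof.
elim: vs L => [|v vs IHvs] L /=.
  by move=> LN xN; exists (fun=> 0); rewrite big_ord0 subr0 LN.
move=> [_ Xv /IHvs cN] /cN[c /(adjoinP _ Xv)[d xL]].
exists (fun i => if i is j.+1 then c j else d).
by rewrite big_ord_recl /= opprD addrCA addrC.
Qed.

Lemma comp_indep L vs N (c : nat -> k) : comp_series L vs N ->
    \sum_(i < size vs) (c i)%:S *: vs`_i \in L ->
  forall i, (i < size vs)%N -> c i = 0.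
Proof.
elim: vs L c => [|v vs IHvs] L c //= [vL Xv cN].
rewrite big_ord_recl /= => cL.
have c0 i : (i < size vs)%N -> c i.+1 = 0.
  apply: (IHvs _ (fun i => c i.+1) cN).
  rewrite -[X in X \in _](addKr ((c 0)%:S *: v)) addrC submodB //.
    exact: adjoin_sub.
  by rewrite rpredZ ?adjoin_mem.
case=> [_|i]; last exact: c0.
move: cL; rewrite big1 ?addr0; last by move=> i _; rewrite c0 // rmorph0 scale0r.
move=> cvL; apply: contraNeq vL => Nc0.
by rewrite -[v]scale1r -(rmorph1 (@fpsC n k)) -(mulVf Nc0) rmorphM -scalerA rpredZ.
Qed.

(** The adjoined vectors form a k-basis modulo L, and phi reads the coefficient of the first one.
    Uniqueness of coordinates makes phi linear even though they are obtained by choice. *)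
Lemma comp_functional L v vs N : comp_series L (v :: vs) N -> (forall x, x \in N) ->
  exists phi : M -> k,
    [/\ forall x y, phi (x + y) = phi x + phi y,
        forall c x, phi (c%:S *: x) = c * phi x,
        forall x, x \in L -> phi x = 0 & phi v = 1].
Proof.
move=> cN Nfull.
have /choice[co coP] := fun x => comp_coord cN (Nfull x).
pose phi x := co x 0%N; exists phi.
have phiE x (c : nat -> k) :
    x - \sum_(i < size (v :: vs)) (c i)%:S *: (v :: vs)`_i \in L -> phi x = c 0%N.
  move=> xL; apply/eqP; rewrite -subr_eq0; apply/eqP.
  apply: (comp_indep (c := fun i => co x i - c i) cN) => //.
  under eq_bigr => i _ do rewrite rmorphB scalerBl.
  rewrite sumrB -(subrK x (\sum_(i < _) (co x i)%:S *: _)) -addrA rpredD //.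
  by rewrite -opprB submodN.
split.
- move=> x y; apply: (phiE _ (fun i => co x i + co y i)).
  under eq_bigr => i _ do rewrite rmorphD scalerDl.
  by rewrite big_split opprD addrACA rpredD.
- move=> c x; apply: (phiE _ (fun i => c * co x i)).
  under eq_bigr => i _ do rewrite rmorphM -scalerA.
  by rewrite -scaler_sumr -scalerBr rpredZ.
- move=> x xL; apply: (phiE _ (fun=> 0)).
  by rewrite big1 ?subr0 // => i _; rewrite rmorph0 scale0r.
apply: (phiE _ (fun i => (i == 0%N)%:R)).
rewrite big_ord_recl /= rmorph1 scale1r big1 ?addr0 ?subrr ?rpred0 //.
by move=> i _; rewrite rmorph0 scale0r.
Qed.

Lemma comp_kdim L vs N : comp_series L vs N -> (forall x, x \in N) ->
  (forall x, x \in L -> x = 0) -> has_kdim M (size vs).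
Proof.
move=> cN Nfull L0; exists (fun i => vs`_i) => x.
have [c /L0/eqP] := comp_coord cN (Nfull x); rewrite subr_eq0 => /eqP xE.
exists [ffun i => c (val i)]; split.
  by rewrite [LHS]xE; apply: eq_bigr => i _; rewrite ffunE.
move=> d xE'; apply/ffunP => i; rewrite ffunE; apply/eqP; rewrite -subr_eq0.
pose e j := c j - oapp d 0 (insub j).
have eE (j : 'I_(size vs)) : e j = c j - d j by rewrite /e valK.
rewrite -eE; apply/eqP/(comp_indep cN) => //.
under eq_bigr => j _ do rewrite eE rmorphB scalerBl.
by rewrite sumrB -xE -xE' subrr rpred0.
Qed.

Lemma comp_chain L vs N : comp_series L vs N -> exists C : nat -> submodClosed M,
  C 0 = L /\ forall i, (i < size vs)%N ->
    {subset C i <= C i.+1} /\ exists2 x, x \in C i.+1 & x \notin C i.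
Proof.
elim: vs L => [|v vs IHvs] L /=; first by exists (fun=> L).
move=> [vL _ /IHvs[C [C0 chainC]]].
exists (fun i => if i is j.+1 then C j else L); split=> // -[_|i]; last exact: chainC.
by rewrite C0; split; [exact: adjoin_sub | exists v; rewrite ?adjoin_mem].
Qed.

(** Choose x_i in C_(i+1) outside C_i. If l exceeded d, these vectors would satisfy a nontrivial
    relation over k, and solving it for the last x_i with nonzero coefficient would put that x_i in
    C_i. *)
Lemma chain_kdim d l : has_kdim M d -> has_chain M l -> (l <= d)%N.
Proof.
move=> [v vbasis] [C chainC]; rewrite leqNgt; apply/negP => ltdl.
have /choice[co coP] : forall x, exists c : {ffun 'I_d -> k},
    x = \sum_i (c i)%:S *: v i.
  by move=> x; have [c [xE _]] := vbasis x; exists c.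
have /choice[x xP] : forall i : 'I_l, exists x, x \in C i.+1 /\ x \notin C i.
  by move=> i; have [_ [x ? ?]] := chainC i (ltn_ord i); exists x.
have Cmono i j : (i <= j)%N -> (j <= l)%N -> {subset C i <= C j}.
  elim: j => [|j IHj]; first by rewrite leqn0 => /eqP-> _.
  rewrite leq_eqVlt => /orP[/eqP-> _ //|] ij jl y /(IHj ij (ltnW jl)).
  by have [+ _] := chainC j jl; exact.
pose A := \matrix_(i < l, j < d) co (x i) j.
have : kermx A != 0.
  rewrite kermx_eq0 /row_free neq_ltn; apply/orP; left.
  exact: leq_ltn_trans (rank_leq_col A) ltdl.
move=> /rowV0Pn[u /sub_kermxP uA0 u0].
have ux0 : \sum_i (u 0 i)%:S *: x i = 0.
  under eq_bigr => i _ do rewrite (coP (x i)) scaler_sumr.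
  rewrite exchange_big big1 //= => j _.
  under eq_bigr => i _ do rewrite scalerA -rmorphM.
  rewrite -scaler_suml -rmorph_sum.
  have -> : \sum_i u 0 i * co (x i) j = (u *m A) 0 j.
    by rewrite mxE; apply: eq_bigr => i _; rewrite mxE.
  by rewrite uA0 mxE rmorph0 scale0r.
have [i0 ui0] : exists i, u 0 i != 0.
  by apply/existsP; apply: contraNT u0 => /existsPn u0; apply/eqP/rowP => i;
     rewrite mxE; apply/eqP; move: (u0 i); rewrite negbK.
case: (arg_maxnP (P := fun i => u 0 i != 0) val ui0) => i ui imax.
have [_ /negP[]] := xP i.
rewrite -[x i]scale1r -(rmorph1 (@fpsC n k)) -(mulVf ui) rmorphM -scalerA rpredZ //.
move: ux0; rewrite (bigD1 i) //= => /eqP; rewrite addr_eq0 => /eqP->.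
apply/submodN/rpred_sum => j ji; have [uj|] := eqVneq (u 0 j) 0.
  by rewrite uj rmorph0 scale0r rpred0.
move=> /imax ij; rewrite rpredZ //; apply: (Cmono j.+1); last by case: (xP j).
  by rewrite ltn_neqAle; apply/andP.
exact: ltnW.
Qed.

Lemma comp_length L vs N : comp_series L vs N -> (forall x, x \in N) ->
  (forall x, x \in L -> x = 0) -> has_length M (size vs).
Proof.
move=> cN Nfull L0; split; last by move=> l; apply/chain_kdim/(comp_kdim cN).
by have [C [_ chainC]] := comp_chain cN; exists C.
Qed.

End OneModule.

(* The map g need only be linear modulo L', so that it may be given by a
   choice of representatives. *)
Lemma comp_transfer (M M' : lmodType R) (g : M -> M')
    (L N : submodClosed M) (L' N' : submodClosed M') vs :
    {subset L' <= N'} ->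
    (forall x, x \in N -> g x \in N') ->
    (forall a x y, x \in N -> y \in N -> g (a *: x + y) - (a *: g x + g y) \in L') ->
    (forall x, x \in N -> (g x \in L') = (x \in L)) ->
    (forall z, z \in N' -> exists2 x, x \in N & z - g x \in L') ->
  comp_series L vs N -> comp_series L' (map g vs) N'.
Proof.
move=> + gN; elim: vs L L' => [|v vs IHvs] L L' L'N' glin gL gS cN.
  move=> z; apply/idP/idP => [/L'N'//|/gS[x xN zL']].
  by rewrite -(subrK (g x) z) rpredD // gL // [_ \in _]cN.
have LN := comp_sub cN; move: cN => /= [vL Xv cN].
have vN : v \in N by apply: (comp_sub cN); apply: adjoin_mem.
have g0 : g 0 \in L' by rewrite gL rpred0.
have XgvL i : fpsX k i *: g v \in L'.
  have XvN : fpsX k i *: v \in N by rewrite rpredZ.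
  have := glin (fpsX k i) _ _ vN (rpred0 N); rewrite addr0 => H.
  rewrite -[X in X \in _](addrK (g 0)) submodB // -(subKr (g (fpsX k i *: v)) (_ + _)).
  by rewrite submodB // gL.
split=> //; first by rewrite gL.
apply: (IHvs (adjoin L v)) => //.
- by apply: adjoin_min => //; apply: gN.
- by move=> a x y xN yN; apply: adjoin_sub; apply: glin.
- move=> x xN; have gxE c : (g x - c%:S *: g v \in L') = (x - c%:S *: v \in L).
    have xvN : x - c%:S *: v \in N by rewrite submodB ?rpredZ.
    rewrite -gL //; have := glin (- c%:S) _ _ vN xN.
    rewrite !scaleNr [- _ + x]addrC [- _ + g x]addrC => H.
    apply/idP/idP => gL'; first by rewrite -(subrK (g x - c%:S *: g v) (g _)) rpredD.
    by rewrite -(subKr (g (x - c%:S *: v)) (_ - _)) submodB.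
  apply/idP/idP.
    by move=> /(adjoinP _ XgvL)[c]; rewrite gxE => ?; apply/(adjoinP _ Xv); exists c.
  by move=> /(adjoinP _ Xv)[c]; rewrite -gxE => ?; apply/(adjoinP _ XgvL); exists c.
- by move=> z /gS[x xN zL']; exists x => //; apply: adjoin_sub.
Qed.

(** A series from L to R adjoins monomials by decreasing degree: multiplying by a variable raises
    the degree, so the product is already present. Restriction then yields the series up to P. *)
Lemma comp_exists N (L P : ideal R) :
    (forall i, fpsX k i ^+ N \in L) -> {subset L <= P} ->
  exists vs, comp_series L vs P.
Proof.
move=> XL LP.
suff [vs cR] : exists vs, comp_series L vs (fullmod R^o).
  apply: (comp_restrict cR) => [x _|x]; first exact: in_fullmod.
  by apply/idP/andP => [xL|[]//]; split=> //; apply: LP.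
have monL := mon_ideal_sub XL.
(* A monomial with all exponents below N has degree at most n N, so series with terms only in
   degrees at least t lie in L. *)
pose t := (n * N).+1; pose ge (m1 m2 : 'X_{1..n}) := (mdeg m2 <= mdeg m1)%N.
pose s0 := sort ge [seq bmnm m | m <- enum {: 'X_{1..n < t}}].
have bigL (f : R) : (forall m, (mdeg m < t)%N -> f m = 0) -> f \in L.
  move=> f0; apply/monL/mon_idealP => m sm; apply: f0.
  rewrite ltnS mdegE -[n in (n * _)%N]card_ord -sum_nat_const leq_sum // => i _.
  by apply/ltnW/sm.
have bigM m : (t <= mdeg m)%N -> fpsM k m \in L.
  move=> tm; apply: bigL => m' lt; rewrite /=; case: eqP lt => // ->.
  by rewrite ltnNge tm.
have s0sort : sorted ge s0.
  by apply: sort_sorted => m1 m2; rewrite /ge leq_total.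
have ge_trans : transitive ge by move=> m2 m1 m3 /[swap]; apply: leq_trans.
(* The invariant of the induction: each monomial is still listed or already in the current L. *)
have s0all m : m \in s0 \/ fpsM k m \in L.
  case: (ltnP (mdeg m) t) => [lt|]; [left | by right; apply: bigM].
  rewrite mem_sort; apply/mapP; exists (BMultinom lt) => //.
  by rewrite mem_enum.
elim: s0 L {XL LP monL bigM} bigL s0sort s0all => [|m s IHs] L bigL.
  move=> _ all; exists [::] => f; rewrite in_fullmod.
  rewrite -(subrK (\sum_(m : 'X_{1..n < t}) (f m)%:S * fpsM k m) f).
  apply: rpredD; last first.
    by apply: rpred_sum => m _; apply: rpredZ; case: (all m).
  apply: bigL => m lt; rewrite fpsBE fps_sumE.
  under eq_bigr => b _ do rewrite fpsCME.
  rewrite (bigD1 (BMultinom lt)) //= eqxx mulr1 big1 ?addr0 ?subrr // => b Nb.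
  case: eqP => [mE|]; last by rewrite mulr0.
  by case/eqP: Nb; apply: val_inj.
rewrite /= path_sortedE // => /andP[/allP gem ssort] all.
have [mL|mL] := boolP (fpsM k m \in L).
  apply: IHs => // m'; case: (all m'); last by right.
  by rewrite inE => /orP[/eqP->|]; [right | left].
have [||vs cR] := IHs (adjoin L (fpsM k m : R^o)) _ ssort.
- by move=> f f0; apply/adjoin_sub/bigL.
- move=> m'; case: (all m'); last by right; apply: adjoin_sub.
  by rewrite inE => /orP[/eqP->|]; [right; apply: adjoin_mem | left].
exists (fpsM k m :: vs); split=> // i.
rewrite [_ *: _]fpsMM; case: (all (U_(i) + m)%MM) => //.
have Nge : ~ (mdeg (U_(i) + m)%MM <= mdeg m)%N by rewrite mdegD mdeg1 add1n ltnn.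
rewrite inE => /orP[/eqP Um|/gem//].
by case: Nge; rewrite Um.
Qed.

End CompositionSeries.

(** * Quotient modules and the symmetric square *)

Section QuotientModule.
Variables (R : comNzRingType) (M : lmodType R) (N : submodClosed M).

Lemma quotmod_pi0 : \pi_(quotmod N) 0 = 0.
Proof. by apply: (addrI (\pi_(quotmod N) 0)); rewrite -quotmod_piD !addr0. Qed.

Lemma quotmod_pi_eq0 x : (\pi_(quotmod N) x == 0) = (x \in N).
Proof. by rewrite -quotmod_pi0 -quotmod_eqP subr0. Qed.

Lemma quotmod_piB x y :
  \pi_(quotmod N) (x - y) = \pi_(quotmod N) x - \pi_(quotmod N) y.
Proof. by apply: (addIr (\pi_(quotmod N) y)); rewrite -quotmod_piD !subrK. Qed.

End QuotientModule.

Section SymmetricSquare.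
Variables (R : comNzRingType) (M : lmodType R).
Local Notation F := {freeg (M * M)%type / R}.
Local Notation pi := (\pi_(sym2 M) : F -> sym2 M).
Local Notation e x y := (<< (x, y) >> : F).

Lemma sym2_rel_pi v : sym2_rel v -> pi v = 0.
Proof. by move=> relv; apply/eqP; rewrite quotmod_pi_eq0; apply: span_gen. Qed.

Lemma sym2_piD u v : pi (u + v) = pi u + pi v. Proof. exact: quotmod_piD. Qed.
Lemma sym2_piZ a v : pi (a *: v) = a *: pi v. Proof. exact: quotmod_piZ. Qed.
Lemma sym2_piN v : pi (- v) = - pi v.
Proof. by rewrite -scaleN1r sym2_piZ scaleN1r. Qed.

Lemma sym2_mulC (x y : M) : sym2_mul x y = sym2_mul y x.
Proof.
apply/eqP; rewrite -subr_eq0 -sym2_piN -sym2_piD; apply/eqP.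
exact/sym2_rel_pi/Sym2_swap.
Qed.

Lemma sym2_mulDl (z x y : M) : sym2_mul (x + y) z = sym2_mul x z + sym2_mul y z.
Proof.
apply/eqP; rewrite -subr_eq0 opprD addrA -!sym2_piN -!sym2_piD; apply/eqP.
exact/sym2_rel_pi/Sym2_addl.
Qed.
Lemma sym2_mulZl a (z x : M) : sym2_mul (a *: x) z = a *: sym2_mul x z.
Proof.
apply/eqP; rewrite -subr_eq0 -sym2_piZ -sym2_piN -sym2_piD; apply/eqP.
exact/sym2_rel_pi/Sym2_scalel.
Qed.
Lemma sym2_mul_linear (z : M) : linear ((@sym2_mul R M)^~ z).
Proof. by move=> a x y; rewrite sym2_mulDl sym2_mulZl. Qed.
Lemma sym2_mul0l (z : M) : sym2_mul 0 z = 0.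
Proof. by rewrite -[X in sym2_mul X _](scale0r 0) sym2_mulZl scale0r. Qed.
Lemma sym2_mul_suml (z : M) (m : nat) (a : 'I_m -> M) :
  sym2_mul (\sum_i a i) z = \sum_i sym2_mul (a i) z.
Proof.
by elim/big_rec2: _ => [|i x y _ <-]; rewrite ?sym2_mul0l ?sym2_mulDl.
Qed.

Lemma freegU_scale (a : R) (p : M * M) : << a *g p >> = a *: << p >> :> F.
Proof. by apply/eqP/freeg_eqP => q; rewrite coeffZ !coeffU mul1r. Qed.

Lemma sym2_ind (P : sym2 M -> Prop) : P 0 ->
    (forall q r, P q -> P r -> P (q + r)) ->
    (forall a x y, P (a *: sym2_mul x y)) ->
  forall q, P q.
Proof.
move=> P0 PD PZ q; elim/quotW: q => v.
rewrite -[v]freeg_sumE; elim: (dom v) => [|[x y] s IHs].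
  by rewrite big_nil [\pi _](_ : _ = 0) //; apply/eqP; rewrite quotmod_pi_eq0 rpred0.
by rewrite big_cons freegU_scale [\pi _]sym2_piD sym2_piZ; apply: PD => //; exact: PZ.
Qed.

(* A map M x M -> R that is symmetric bilinear modulo K induces Sym^2 M -> R/K;
   it is described here by representatives. *)
Lemma sym2_lift (K : submodClosed R^o) (B : M -> M -> R) :
    (forall x y, B x y = B y x) ->
    (forall x y z, B (x + y) z - B x z - B y z \in K) ->
    (forall a x z, B (a *: x) z - a * B x z \in K) ->
  exists L : sym2 M -> R,
    [/\ forall q r, L (q + r) - (L q + L r) \in K,
        forall a q, L (a *: q) - a * L q \in K
      & forall x y, L (sym2_mul x y) - B x y \in K].
Proof.
move=> BC BD BZ.
pose l : F -> R^o := fglift (fun p : M * M => B p.1 p.2 : R^o).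
have lU a x y : l << a *g (x, y) >> = a * B x y by exact: liftU.
have lB : {morph l : u v / u - v} by exact: lift_is_additive.
have l0 : l 0 = 0 by rewrite -(subrr 0) lB subrr.
have lN u : l (- u) = - l u by rewrite -sub0r lB l0 sub0r.
have lD u v : l (u + v) = l u + l v by rewrite -{1}[v]opprK lB lN opprK.
have lE v : l v = \sum_(p <- dom v) coeff p v * B p.1 p.2.
  rewrite -{1}[v]freeg_sumE (big_morph l lD l0).
  by apply: eq_bigr => -[x y] _; rewrite lU.
have lZ a v : l (a *: v) = a * l v.
  rewrite [a *: v]/(fgscale a v) /fgscale (big_morph l lD l0) lE mulr_sumr.
  by apply: eq_bigr => -[x y] _; rewrite lU mulrA.
have BCr x y z : B x (y + z) - B x y - B x z \in K by rewrite !(BC x).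
have l_rel v : v \in span (@sym2_rel R M) -> l v \in K.
  move: v; apply: span_ind; first by rewrite l0; exact: rpred0.
    by move=> u v uK vK; rewrite lD; apply: (rpredD uK vK).
  move=> a v relv; rewrite lZ; apply: (rpredZ a).
  case: {v} relv => [x y z|x y z|b x y|b x y|x y]; rewrite !lB ?lZ !lU !mul1r.
  - exact: BD.
  - exact: BCr.
  - exact: BZ.
  - by rewrite !(BC x); exact: BZ.
  - by rewrite BC subrr; exact: rpred0.
exists (fun q => l (repr q)).
have lpi v : l (repr (pi v)) - l v \in K.
  by rewrite -lB; apply: l_rel; rewrite quotmod_eqP reprK.
split.
- move=> q r; rewrite -lD -lB; apply: l_rel; rewrite quotmod_eqP reprK.
  by rewrite quotmod_piD !reprK.
- move=> a q; rewrite -lZ -lB; apply: l_rel; rewrite quotmod_eqP reprK.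
  by rewrite quotmod_piZ reprK.
- by move=> x y; rewrite -[B x y]mul1r -[1 * _]lU; apply: lpi.
Qed.

End SymmetricSquare.

(** * Products of ideals and elements of submodules *)

Section Products.
Variable R : comNzRingType.
Implicit Types I J : ideal R.

Lemma idealM_mem I J (x y : R) : x \in I -> y \in J -> x * y \in idealM I J.
Proof. by move=> xI yJ; apply: span_gen; exists x, y. Qed.

Lemma idealM_sub I J (L : ideal R) :
  (forall x y : R, x \in I -> y \in J -> x * y \in L) -> {subset idealM I J <= L}.
Proof. by move=> sub; apply: span_sub => _ [x [y [xI yJ ->]]]; apply: sub. Qed.

End Products.

Section SubmodVal.
Variables (R : comNzRingType) (M : lmodType R) (N : submodClosed M).
Lemma submod_valB (x y : submod N) : submod_val (x - y) = submod_val x - submod_val y.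
Proof. exact: (raddfB (val : submod N -> M)). Qed.
Lemma submod_valD (x y : submod N) : submod_val (x + y) = submod_val x + submod_val y.
Proof. exact: (raddfD (val : submod N -> M)). Qed.
Lemma submod_valZ a (x : submod N) : submod_val (a *: x) = a *: submod_val x.
Proof. exact: (linearZ_LR (val : submod N -> M)). Qed.
Lemma submod_val_sum m (x : 'I_m -> submod N) :
  submod_val (\sum_i x i) = \sum_i submod_val (x i).
Proof. exact: (raddf_sum (val : submod N -> M)). Qed.
End SubmodVal.

(** * The kernel delta(I) for I = J + (f), when J has vanishing first Koszul homology *)

Section AlmostCompleteIntersection.
Variables (R : comNzRingType) (n : nat) (f : R) (p : nat -> R) (J I : ideal R).
Hypothesis pJ : forall i, p i \in J.
Hypothesis JE : forall x : R, x \in J -> exists a : nat -> R, x = \sum_(i < n) a i * p i.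
Hypothesis fI : f \in I.
Hypothesis JI : {subset J <= I}.
Hypothesis IE : forall x : R, x \in I -> exists b, x - b * f \in J.
Hypothesis koszul : forall a : nat -> R, \sum_(i < n) a i * p i = 0 ->
  exists2 w : kos R n, kos_hom 2 w & kos_vec a n = kosd p w.

Let K : ideal R := colon J (f : R^o).
Let P : ideal R := colon (idealM J I) (f * f : R^o).

Let pI i : p i \in I. Proof. exact/JI/pJ. Qed.
Let e i : submod I := Submod (pI i).
Let F : submod I := Submod fI.
Local Notation "x @ y" := (sym2_mul x y : sym2 (submod I)) (at level 40).

Lemma colon_sub_colon2 : {subset K <= P}.
Proof.
move=> c cf; rewrite colonE (_ : c *: _ = (c * f) * f); last exact: mulrA.
exact: idealM_mem.
Qed.

Lemma mul_ideal_coord (z : R) : z \in idealM J I ->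
  exists A : nat -> submod I, z = \sum_(i < n) submod_val (A i) * p i.
Proof.
move: z; apply: (@span_ind _ _ _ (fun z : R^o => exists A : nat -> submod I,
  z = \sum_(i < n) submod_val (A i) * p i)).
- by exists (fun=> 0); rewrite big1 // => i _; rewrite mul0r.
- move=> x y [A ->] [B ->]; exists (fun i => A i + B i).
  by rewrite -big_split; apply: eq_bigr => i _; rewrite mulrDl.
move=> a _ [x [y [/JE[c ->] yI ->]]].
exists (fun i => (a * c i) *: (Submod yI)).
rewrite [LHS]mulrA mulr_sumr mulr_suml; apply: eq_bigr => i _ /=.
by rewrite -[_ *: _]/(a * c i * y) -!mulrA; congr (_ * (_ * _)); rewrite mulrC.
Qed.

Lemma submod_coord (x : submod I) : exists b (a : nat -> R),
  x = b *: F + \sum_(i < n) a i *: e i.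
Proof.
have [b /JE[a xE]] := IE (valP x); exists b, a; apply: val_inj.
by rewrite raddfD raddf_sum /= -[LHS](subrK (b * f)) addrC xE; congr (_ + _).
Qed.

(** The syzygy is a Koszul boundary, so [kosd_hom2_sym] applies with the inclusion of I as [psi] and
    the symmetric product as [B]. The coefficients it returns are the A_i themselves, because the
    inclusion is injective. *)
Lemma sym2_sum_eq0 (A : nat -> submod I) :
  \sum_(i < n) submod_val (A i) * p i = 0 :> R -> \sum_(i < n) A i @ e i = 0.
Proof.
move=> A0; have [w w2 wE] := @koszul (fun i => submod_val (A i)) A0.
have [B [dw sB]] := @kosd_hom2_sym R p (submod I) (sym2 (submod I)) val e
  (@sym2_mul R (submod I)) n w (fun=> erefl)
  (@sym2_mul_linear R (submod I)) (@sym2_mulC R (submod I)) w2.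
apply: etrans sB; apply: eq_bigr => i _; congr (_ @ _); apply: val_inj.
exact: (kos_vec_inj (etrans wE dw) (ltn_ord i)).
Qed.

Lemma sym2_coord (q : sym2 (submod I)) : exists c (A : nat -> submod I),
  q = c *: (F @ F) - \sum_(i < n) A i @ e i.
Proof.
move: q; apply: sym2_ind.
- by exists 0, (fun=> 0); rewrite scale0r big1 ?subr0 // => i _; rewrite sym2_mul0l.
- move=> _ _ [c [A ->]] [d [B ->]]; exists (c + d), (fun i => A i + B i).
  rewrite scalerDl addrACA -opprD -big_split; congr (_ - _).
  by apply: eq_bigr => i _; rewrite sym2_mulDl.
move=> a x y; have [b [u xE]] := submod_coord x; have [c [v yE]] := submod_coord y.
(* With x = b F + sum u_i e_i and y = c F + sum v_i e_i, first x is expanded in x.y, then y in F.y;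
   only the term b c F.F contains no e_i. *)
exists (a * b * c), (fun i => - (a * b * v i) *: F - (a * u i) *: y).
have yF : y @ F = c *: (F @ F) + \sum_(i < n) v i *: (e i @ F).
  by rewrite yE sym2_mulDl sym2_mulZl sym2_mul_suml; under eq_bigr do rewrite sym2_mulZl.
rewrite {1}xE sym2_mulDl sym2_mulZl sym2_mul_suml (sym2_mulC F) yF.
rewrite !scalerDr !scalerA -addrA; congr (_ + _).
rewrite !scaler_sumr -big_split -sumrN; apply: eq_bigr => i _ /=.
rewrite -scaleNr sym2_mulDl !sym2_mulZl !scaleNr opprD !opprK !scalerA.
by rewrite !(sym2_mulC (e i)).
Qed.

Lemma sym2_to_sq_coord c (A : nat -> submod I) :
  submod_val (sym2_to_sq (c *: (F @ F) - \sum_(i < n) A i @ e i)) =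
  c * (f * f) - \sum_(i < n) submod_val (A i) * p i :> R.
Proof.
rewrite sym2_to_sq_linear raddfN raddf_sum.
rewrite submod_valB submod_valZ submod_val_sum sym2_to_sq_mul.
by congr (_ - _); apply: eq_bigr => i _; rewrite sym2_to_sq_mul.
Qed.

(** Modulo J each x in I is [co x] times f, and [co x] is determined and linear modulo K. The form
    [co x * co y] thus induces a map from the symmetric square to R/K that kills each product with
    e_i and sends F.F to 1. *)
Lemma sym2_coord_eq0 c (A : nat -> submod I) :
  c *: (F @ F) = \sum_(i < n) A i @ e i -> c \in K.
Proof.
move=> cE.
have /choice[co coP] : forall x : submod I, exists b, submod_val x - b * f \in J.
  by move=> x; apply/IE/valP.
have KP a : (a * f \in J) -> a \in K by [].
pose B x y := co x * co y.
have [|||L [LD LZ LB]] := @sym2_lift R (submod I) K B.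
- by move=> x y; rewrite /B mulrC.
- move=> x y z; rewrite /B -!mulrBl mulrC; apply: (rpredZ (co z)); apply: KP.
  rewrite !mulrBl.
  have -> : co (x + y) * f - co x * f - co y * f =
      (submod_val x - co x * f) + (submod_val y - co y * f) - (submod_val (x + y) - co (x + y) * f).
    rewrite submod_valD; move: (submod_val x : R) (submod_val y : R) => vx vy.
    ring.
  by apply: submodB => //; apply: rpredD.
- move=> a x z; rewrite /B mulrA -mulrBl mulrC; apply: (rpredZ (co z)); apply: KP.
  rewrite mulrBl -mulrA.
  have -> : co (a *: x) * f - a * (co x * f) =
      a * (submod_val x - co x * f) - (submod_val (a *: x) - co (a *: x) * f).
    rewrite submod_valZ -[a *: submod_val x]/(a * submod_val x).
    move: (submod_val x : R) => vx; ring.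
  by apply: submodB => //; apply: (rpredZ a).
have L0 : L 0 \in K.
  have -> : L 0 = - (L (0 + 0) - (L 0 + L 0)) by rewrite [0 + 0]addr0; ring.
  exact/submodN/LD.
have Lsum m (u : 'I_m -> sym2 (submod I)) : (forall i, L (u i) \in K) -> L (\sum_i u i) \in K.
  move=> uK; elim/big_rec: _ => // i q _ qK.
  by rewrite -(subrK (L (u i) + L q) (L _)); apply: (rpredD (LD _ _)); apply: rpredD.
have LpK i : L (A i @ e i) \in K.
  rewrite -(subrK (B (A i) (e i)) (L _)); apply: (rpredD (LB _ _)).
  apply: (rpredZ (co (A i))); apply: KP.
  by rewrite -[_ * f](subKr (submod_val (e i))); apply: submodB => //; apply: pJ.
have LFK : L (c *: (F @ F)) \in K by rewrite cE; apply: Lsum.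
have cBK : c * B F F \in K.
  have -> : c * B F F = L (c *: (F @ F)) - (L (c *: (F @ F)) - c * L (F @ F))
     - c * (L (F @ F) - B F F) by ring.
  by apply: submodB; [apply: submodB | apply: (rpredZ c)].
have coF1 : co F - 1 \in K.
  apply: KP; rewrite mulrBl mul1r -opprB; apply: submodN; exact: (coP F).
(* The choice [co F] is only congruent to 1 modulo K, whence the factorization of [co F] squared
   minus 1. *)
have -> : c = c * B F F - (c * (co F + 1)) * (co F - 1) by rewrite /B; ring.
by apply: submodB => //; apply: (rpredZ (c * _)).
Qed.

Let deltaI : lmodType R := submod (ker_lin (@sym2_to_sq R I)).

Lemma delta_presentation : exists g : R -> deltaI,
  [/\ forall (a x y : R), x \in P -> y \in P -> g (a * x + y) = a *: g x + g y,
      forall c : R, c \in P -> g c = 0 <-> c \in K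
    & forall z, exists2 c, c \in P & g c = z].
Proof.
have /choice[A AP] : forall c : R, exists A : nat -> submod I,
    c \in P -> c * (f * f) = \sum_(i < n) submod_val (A i) * p i.
  move=> c; have [cP|] := boolP (c \in P); last by exists (fun=> 0).
  by have [A] := mul_ideal_coord cP; exists A.
pose G c := c *: (F @ F) - \sum_(i < n) A c i @ e i.
have Gker (c : R) : c \in P -> G c \in ker_lin (@sym2_to_sq R I).
  move=> cP; rewrite inE; apply/eqP/val_inj.
  by rewrite [LHS]sym2_to_sq_coord -AP ?subrr.
(* The value of G does not depend on the chosen coefficients: two choices differ by a syzygy of the
   p_i with entries in I, which [sym2_sum_eq0] kills. *)
have GE (c : R) (B : nat -> submod I) : c \in P ->
    c * (f * f) = \sum_(i < n) submod_val (B i) * p i ->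
    G c = c *: (F @ F) - \sum_(i < n) B i @ e i.
  move=> cP cB; congr (_ - _); apply/eqP; rewrite -subr_eq0 -sumrB; apply/eqP.
  under eq_bigr => i _ do rewrite -scaleN1r -sym2_mulZl -sym2_mulDl.
  apply: (sym2_sum_eq0 (A := fun i => A c i + -1 *: B i)).
  under eq_bigr => i _ do rewrite scaleN1r submod_valB mulrBl.
  by rewrite sumrB -cB -AP ?subrr.
(* On P the value G c lies in the kernel, so the default 0 is never taken there. *)
pose g c : submod (ker_lin (@sym2_to_sq R I)) := insubd 0 (G c).
have gE (c : R) : c \in P -> submod_val (g c) = G c.
  by move=> cP; rewrite -[LHS]/(val _) val_insubd Gker.
exists g; split.
- move=> a x y xP yP; apply: val_inj => /=.
  have axyP : a * x + y \in P by apply: (rpredD (rpredZ a xP) yP).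
  rewrite !gE //.
  rewrite (GE _ (fun i => a *: A x i + A y i)) //; last first.
    rewrite mulrDl -mulrA !AP // mulr_sumr -big_split; apply: eq_bigr => i _.
    by rewrite submod_valD submod_valZ mulrDl mulrA.
  rewrite scalerDl scalerBr scalerA; rewrite [RHS]addrACA; congr (_ + _).
  rewrite -opprD scaler_sumr -big_split; congr (- _); apply: eq_bigr => i _.
  by rewrite sym2_mulDl sym2_mulZl.
- move=> c cP; split=> [gc0|cK].
    have := gE c cP; rewrite gc0 => /esym/eqP.
    by rewrite subr_eq0 => /eqP/sym2_coord_eq0.
  apply: val_inj => /=; rewrite [LHS]gE //.
  have [b cE] : exists b : nat -> R, c * f = \sum_(i < n) b i * p i := JE cK.
  (* From c f = sum b_i p_i, the elements b_i f serve as coefficients of c f^2, and sum (b_i F).e_i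
     = F.(c F) cancels c F.F. *)
  rewrite (GE _ (fun i => b i *: F)) //; last first.
    rewrite mulrA cE mulr_suml; apply: eq_bigr => i _.
    by rewrite submod_valZ mulrAC.
  under eq_bigr => i _ do rewrite sym2_mulZl sym2_mulC -sym2_mulZl.
  rewrite -sym2_mul_suml -sym2_mulZl (_ : c *: F = \sum_(i < n) b i *: e i) ?subrr //.
  apply: val_inj; rewrite [RHS]submod_val_sum [LHS]cE.
  by apply: eq_bigr => i _; rewrite submod_valZ.
move=> [q qker]; have [c [B qE]] := sym2_coord q.
have cB : c * (f * f) = \sum_(i < n) submod_val (B i) * p i.
  move: (qker); rewrite inE => /eqP/(congr1 (@submod_val _ _ _)).
  by rewrite qE [LHS]sym2_to_sq_coord => /eqP; rewrite subr_eq0 => /eqP.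
have cP : c \in P.
  rewrite colonE [_ *: _]cB; apply: rpred_sum => i _.
  by rewrite mulrC; apply: idealM_mem; [exact: pJ | exact: valP].
exists c => //; apply: val_inj; rewrite /= [LHS]gE //.
by rewrite (GE _ B) // -qE.
Qed.

End AlmostCompleteIntersection.

(** * The perfect pairing on R modulo the (N+1)-th powers of the variables *)

Section Duality.
Variables (n N : nat) (k : fieldType).
Local Notation R := (fps n k).
(** The socle monomial of this quotient; u and v pair to the coefficient of u v at [top]. *)
Let top : 'X_{1..n} := [multinom N | i < n].

Lemma small_le_top m : small_upto N.+1 n m -> (m <= top)%MM.
Proof. by move=> sm; apply/mnm_lepP => i; rewrite mnmE -ltnS; apply: sm. Qed.

Lemma top_functional (phi : R -> k) :
    (forall x y : R, phi (x + y) = phi x + phi y) ->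
    (forall c (x : R), phi (fpsC n c * x) = c * phi x) ->
    (forall x : R, x \in mon_ideal N.+1 n -> phi x = 0) ->
  exists c : R, forall z, (c * z) top = phi z.
Proof.
move=> phiD phiC phi0.
have phi00 : phi 0 = 0 by apply: phi0; exact: rpred0.
pose t := (n * N).+1; pose small (m : 'X_{1..n < t}) := [forall i, (m i < N.+1)%N].
have smallP (m : 'X_{1..n < t}) : small m -> small_upto N.+1 n m.
  by move=> /forallP sm i _; apply: sm.
(* The coefficient of x^(top - m) z at [top] is the coefficient of z at m, so the monomials x^(top -
   m) are dual to the x^m. *)
exists (\sum_(m | small m) fpsC n (phi (fpsM k m)) * fpsM k (top - m)%MM) => z.
rewrite mulr_suml fps_sumE.
transitivity (phi (\sum_(m | small m) fpsC n (z m) * fpsM k m)).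
  rewrite (big_morph phi phiD phi00); apply: eq_bigr => m sm.
  rewrite phiC -mulrA fpsCME mulrC; congr (_ * _).
  by rewrite -[X in fpscoef _ X](submK (small_le_top (smallP _ sm))) fpsM_shift.
apply/esym/eqP; set u := \sum_(m | _) _; rewrite -{1}(subrK u z) phiD phi0 ?add0r //.
apply/mon_idealP => m sm; rewrite fpsBE fps_sumE.
have lt : (mdeg m < t)%N.
  rewrite ltnS mdegE -[n in (n * _)%N]card_ord -sum_nat_const leq_sum // => i _.
  by rewrite -ltnS; apply: sm.
under eq_bigr => b _ do rewrite fpsCME.
rewrite (bigD1 (BMultinom lt)) /=; last by apply/forallP => i; apply: sm.
rewrite eqxx mulr1 big1 ?addr0 ?subrr // => b /andP[_ Nb].
case: eqP => [mE|]; last by rewrite mulr0.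
by case/eqP: Nb; apply: val_inj.
Qed.

(** The coefficient of c z at m is that of c x^(top - m) z at [top], namely phi of an element of
    L. *)
Lemma annihilator_functional (phi : R -> k) (c : R) (L : ideal R) :
    (forall z, (c * z) top = phi z) -> (forall z, z \in L -> phi z = 0) ->
  forall z : R, z \in L -> c * z \in mon_ideal N.+1 n.
Proof.
move=> ctop phiL z zL; apply/mon_idealP => m sm.
rewrite -(fpsM_shift (top - m)%MM) submK; last exact: small_le_top.
rewrite mulrCA ctop; apply: phiL; exact: (rpredZ _ zL).
Qed.

End Duality.

(** * The Jacobian and Tjurina ideals of an isolated singularity *)

Section Hypersurface.
Variables (n : nat) (k : fieldType) (f : fps n k).
Local Notation R := (fps n k).
Hypothesis char0 : [pchar k] =i pred0.
Hypothesis f_isolated : isolated_singularity f.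
Let J := jacobian_ideal f.
Let I := tjurina_ideal f.
Let K : ideal R := colon J (f : R^o).
Let P : ideal R := colon (idealM J I) (f * f : R^o).

(** The partials, extended by 0 to all natural indices to fit the Koszul complex. *)
Let p (i : nat) : R := oapp (fun j => fps_deriv j f) 0 (insub i).

Lemma pE (i : 'I_n) : p i = fps_deriv i f. Proof. by rewrite /p valK. Qed.

Lemma jac_mem i : p i \in J.
Proof.
rewrite /p; case: insub => [j|]; last exact: rpred0.
by apply: span_gen; exists j.
Qed.

Lemma jac_coord (x : R) : x \in J -> exists a : nat -> R, x = \sum_(i < n) a i * p i.
Proof.
move: x; apply: (@span_ind _ _ _ (fun x : R^o => exists a : nat -> R,
  x = \sum_(i < n) a i * p i)).
- by exists (fun=> 0); rewrite big1 // => i _; rewrite mul0r.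
- move=> x y [a ->] [b ->]; exists (fun i => a i + b i).
  by rewrite -big_split; apply: eq_bigr => i _; rewrite mulrDl.
move=> a _ [j ->]; exists (fun i => (i == j :> nat)%:R * a).
rewrite (bigD1 j) //= eqxx mul1r pE big1 ?addr0 // => i ij.
by rewrite (_ : (i == j :> nat) = false) ?mul0r //; apply/negbTE.
Qed.

Lemma tju_f : f \in I. Proof. by apply: span_gen; left. Qed.
Lemma jac_sub_tju : {subset J <= I}.
Proof. by apply: span_sub => x [i ->]; apply: span_gen; right; exists i. Qed.

Lemma tju_coord (x : R) : x \in I -> exists b, x - b * f \in J.
Proof.
move: x; apply: (@span_ind _ _ _ (fun x : R^o => exists b : R, (x : R) - b * f \in J)).
- by exists 0; rewrite mul0r subr0; exact: rpred0.
- move=> x y [a xJ] [b yJ]; exists (a + b).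
  by rewrite mulrDl opprD addrACA; apply: (rpredD xJ yJ).
move=> a _ [->|[i ->]]; first by exists a; rewrite subrr; exact: rpred0.
exists 0; rewrite mul0r subr0; apply: (rpredZ a); rewrite -pE; exact: jac_mem.
Qed.

Lemma maxideal_cst (x : R) : x \in maxideal n k -> x 0%MM = 0.
Proof.
suff sub : {subset maxideal n k <= mon_ideal 1 n} by move=> /sub/mon_ideal1P.
apply: span_sub => _ [i ->].
apply/mon_ideal1P; rewrite /=; case: eqP => // /mnmP/(_ i).
by rewrite mnm0E mnm1E eqxx.
Qed.

Lemma tju_cst (x : R) : x \in I -> x 0%MM = 0.
Proof.
have [fm dfm _ _] := f_isolated.
suff sub : {subset I <= mon_ideal 1 n} by move=> /sub/mon_ideal1P.
by apply: span_sub => _ [->|[i ->]]; apply/mon_ideal1P/maxideal_cst.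
Qed.

Lemma cst_exp (x : R) m : (x ^+ m) 0%MM = (x 0%MM) ^+ m.
Proof.
elim: m => [|m IHm]; first by rewrite !expr0 /= eqxx.
by rewrite !exprS fps_cstM IHm.
Qed.

Lemma primary_cst (Q : ideal R) (a b : R) : primary Q -> {subset Q <= I} ->
  a * b \in Q -> a \notin Q -> b 0%MM = 0.
Proof.
move=> [_ prQ] QI /prQ[aQ|[m /QI/tju_cst]]; first by rewrite aQ.
by rewrite cst_exp => /eqP; rewrite expf_eq0 => /andP[_ /eqP].
Qed.

Lemma jac_power : exists N, forall i, fpsX k i ^+ N.+1 \in J.
Proof.
have [_ _ [_ Jm] _] := f_isolated.
have /choice[e eP] : forall i : 'I_n, exists e, fpsX k i ^+ e \in J.
  by move=> i; apply/Jm/span_gen; exists i.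
exists (\max_i e i) => i; rewrite -(subnK (leq_trans (leq_bigmax i) (leqnSn _))).
by rewrite exprD; apply: (rpredZ _ (eP i)).
Qed.

Section Syzygy.
Variables (a : nat -> R) (b : R).
Hypothesis syz : b * f + \sum_(i < n) a i * p i = 0.

(** The derivation attached to the syzygy, which says that D f = - b f. *)
Let D (g : R) : R := \sum_(i < n) a i * fps_deriv i g.

Let DM g h : D (g * h) = D g * h + g * D h.
Proof.
rewrite /D mulr_suml mulr_sumr -big_split; apply: eq_bigr => i _ /=.
by rewrite fps_derivM; ring.
Qed.
Let DD g h : D (g + h) = D g + D h.
Proof.
by rewrite /D -big_split; apply: eq_bigr => i _ /=; rewrite fps_derivD mulrDr.
Qed.

Lemma derivation_tju (g : R) : g \in I -> D g \in I.
Proof.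
have Df : D f = - (b * f).
  apply/eqP; rewrite -addr_eq0 addrC -[X in _ == X]syz; apply/eqP; congr (_ + _).
  by apply: eq_bigr => i _; rewrite pE.
have IZ (c x : R) : x \in I -> c * x \in I by move=> xI; exact: (rpredZ c xI).
have pI i : p i \in I by apply/jac_sub_tju/jac_mem.
have DfI : D f \in I by rewrite Df; apply/submodN/IZ/tju_f.
(* [D, d_i] lies in the span of the derivations, so D (d_i f) is d_i (D f)
   up to the Jacobian ideal. *)
have DpI i : D (p i) \in I.
  rewrite /p; case: insub => [j|] /=; last first.
    by rewrite /D big1 => [|l _]; [exact: rpred0 | rewrite fps_deriv0 mulr0].
  have -> : D (fps_deriv j f) = fps_deriv j (D f) - \sum_(l < n) fps_deriv j (a l) * p l.
    rewrite /D fps_deriv_sum -sumrB; apply: eq_bigr => l _.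
    by rewrite fps_derivM pE addrAC subrr add0r fps_derivC.
  apply: submodB; last by apply: rpred_sum => l _; apply: IZ.
  rewrite Df -mulNr fps_derivM -pE mulrC [X in _ + X]mulrC.
  apply: rpredD; first by rewrite mulrC; apply/IZ/tju_f.
  by rewrite mulrC; apply: IZ.
move: g; apply: (@span_ind _ _ _ (fun g : R^o => D g \in I)).
- by rewrite /D big1 => [|l _]; [exact: rpred0 | rewrite fps_deriv0 mulr0].
- by move=> x y xI yI; rewrite DD; exact: rpredD.
move=> c x xIE; rewrite [c *: x]/(c * x) DM.
have [xI DxI] : x \in I /\ D x \in I.
  by case: xIE => [->|[i ->]]; rewrite -?pE; split=> //; apply: tju_f.
by apply: rpredD; apply: IZ.
Qed.

Lemma syzygy_cst j : (j < n)%N -> a j 0%MM = 0.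
Proof.
move=> jn; pose x := fpsX k (Ordinal jn).
have [_ _ _ [[I1 prI] Im]] := f_isolated.
have [e xe] : exists e, x ^+ e \in I.
  by apply/Im/span_gen; exists (Ordinal jn).
elim: e xe => [|e IHe] xe; first by rewrite expr0 (negPf I1) in xe.
have Dx : D (x ^+ e.+1) = e.+1%:R * (x ^+ e * a j).
  rewrite /D (bigD1 (Ordinal jn)) //= big1 => [|i ij].
    by rewrite fps_derivXn fps_derivX eqxx /= addr0; ring.
  by rewrite fps_derivXn fps_derivX (negPf ij) !mulr0.
have xaI : x ^+ e * a j \in I.
  (* Characteristic zero makes e + 1 invertible, so D of x^(e+1) in I yields x^e a_j in I. *)
  have e0 : e.+1%:R != 0 :> k by rewrite ((pcharf0P k).1 char0).
  rewrite (_ : _ * _ = fpsC n e.+1%:R^-1 * D (x ^+ e.+1)).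
    exact/(rpredZ (_ : R))/derivation_tju.
  rewrite Dx -(rmorph_nat (@fpsC n k)) [RHS]mulrA -(rmorphM (@fpsC n k)).
  by rewrite mulVf ?rmorph1 ?mul1r.
(* Either x^e lies in I and the descent continues, or primarity of I forces a_j into the maximal
   ideal. *)
have [|xI] := boolP (x ^+ e \in I); first exact: IHe.
exact: (primary_cst (conj I1 prI) _ xaI xI).
Qed.

End Syzygy.

Section Regularity.
Variable N : nat.
Hypothesis XJ : forall i, fpsX k i ^+ N.+1 \in J.

(** The regular sequence for depth sensitivity: powers of the variables, contained in J by [XJ]. *)
Let y (r : nat) : R := oapp (fun i => fpsX k i ^+ N.+1) 0 (insub r).

Let yE : exists c : nat -> nat -> R, forall r, (r < n)%N ->
  y r = \sum_(i < n) c r i * p i.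
Proof.
have /choice[c cP] : forall r, exists a : nat -> R, y r = \sum_(i < n) a i * p i.
  move=> r; apply: jac_coord; rewrite /y; case: insub => [j|]; first exact: XJ.
  exact: rpred0.
by exists c.
Qed.

Let YS r (a : R) : (r < n)%N ->
  a \in mon_ideal N.+1 r.+1 <-> exists b, a - y r * b \in mon_ideal N.+1 r.
Proof. by move=> rn; rewrite /y insubT; exact: (@mon_idealS n k N.+1 (Ordinal rn) a). Qed.

Let Yreg r (a : R) : (r < n)%N -> y r * a \in mon_ideal N.+1 r -> a \in mon_ideal N.+1 r.
Proof. by move=> rn; rewrite /y insubT; exact: (@mon_ideal_reg n k N.+1 (Ordinal rn) a). Qed.

Lemma jac_koszul (a : nat -> R) : \sum_(i < n) a i * p i = 0 ->
  exists2 w : kos R n, kos_hom 2 w & kos_vec a n = kosd p w.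
Proof.
move=> syz; have [c cE] := yE.
apply: (koszul_H1 cE (@mon_ideal0 n k N.+1) YS Yreg); first exact: kos_vec_hom.
by rewrite kosd_vec syz scale0r.
Qed.

Lemma jac_colon : exists w : R,
  [/\ forall i, (i < n)%N -> p i * w \in mon_ideal N.+1 n,
      forall b, b * w \in mon_ideal N.+1 n -> b \in J
    & forall z, (forall i, (i < n)%N -> p i * z \in mon_ideal N.+1 n) ->
        exists b, z - b * w \in mon_ideal N.+1 n].
Proof.
have [c cE] := yE.
have [w [wJ inj sur]] := colon_cyclic cE (@mon_ideal0 n k N.+1) YS Yreg.
exists w; split=> // b /inj[a ->]; apply: rpred_sum => i _.
apply: (rpredZ (a i)); exact: jac_mem.
Qed.

End Regularity.

Lemma jac_of_colon : {subset P <= K} -> f \in J.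
Proof.
move=> PK; apply: contrapT => /negP fJ.
have [N XJ] := jac_power.
have [_ _ [prJ _] [[I1 _] _]] := f_isolated.
have IZ (c x : R) : x \in I -> c * x \in I by move=> xI; exact: (rpredZ c xI).
have XI i : fpsX k i ^+ N.+1 \in I by apply: jac_sub_tju.
(* The series from I to R is not empty because 1 is not in I; its first vector is s. *)
have [[|s vs] sI] := comp_exists XI (fun x _ => in_fullmod (x : R^o)).
  by move/negP: I1; apply; rewrite [_ \in _]sI; apply: in_fullmod.
have [phi [phiD phiC phiI phis]] := comp_functional sI (@in_fullmod _ _).
have [sNI Xs _] := sI.
have smI (a : R) : a 0%MM = 0 -> s * a \in I.
  by move=> a0; rewrite mulrC; apply: (maximal_kill Xs a0).
(* s is a socle element of R/I, and every syzygy of (p, f) has entries in the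
   maximal ideal, so s times a syzygy has entries in I. *)
have sK (b : R) : b \in K -> b * s \in J.
  move=> bK; have [a bf] := jac_coord (bK : b * f \in J).
  have b0 : b 0%MM = 0.
    apply: (primary_cst prJ jac_sub_tju _ fJ).
    by rewrite mulrC.
  have a0 i : (i < n)%N -> a i 0%MM = 0.
    move=> lt; have := @syzygy_cst (fun i => - a i) b _ i lt.
    rewrite fpsNE => H; apply/eqP; rewrite -oppr_eq0; apply/eqP/H.
    by rewrite bf -big_split big1 //= => j _; rewrite mulNr subrr.
  have [c scJ] := tju_coord (smI _ b0).
  have [e scE] := jac_coord scJ.
  (* With b f = sum a_i p_i and s b - c f = sum e_i p_i, one gets c f^2 = sum p_i (s a_i - e_i f),
     whose cofactors lie in I. So c is in P, hence in K, and s b is in J. *)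
  have cK : c \in K.
    have cff : c * (f * f) = \sum_(i < n) p i * (s * a i - e i * f).
      transitivity (s * (b * f) - (s * b - c * f) * f); first by ring.
      rewrite bf scE mulr_sumr mulr_suml -sumrB.
      by apply: eq_bigr => i _; ring.
    apply: PK; rewrite colonE [_ *: _]cff; apply: rpred_sum => i _.
    apply: idealM_mem; first exact: jac_mem.
    by apply: submodB; [apply/smI/a0 | apply/IZ/tju_f].
  rewrite mulrC -(subrK (c * f) (s * b)); exact: (rpredD scJ cK).
have phi0 (x : R) : x \in mon_ideal N.+1 n -> phi x = 0.
  by move=> xY; apply/phiI/(mon_ideal_sub XI).
have [c ctop] := top_functional phiD phiC phi0.
have cI := annihilator_functional ctop phiI.
have [w [wJ winj wsur]] := jac_colon XJ.
(* As c represents phi, it sends I into Y, the ideal of (N+1)-th powers. In particular c J is in Y,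
   so c = b w modulo Y. *)
have [|b cbw] := wsur c.
  by move=> i _; rewrite mulrC; apply/cI/jac_sub_tju/jac_mem.
have wJ' (x : R) : x \in J -> x * w \in mon_ideal N.+1 n.
  move=> /jac_coord[a ->]; rewrite mulr_suml; apply: rpred_sum => i _.
  by rewrite -mulrA; apply: (rpredZ (a i)); apply: wJ.
(* From c f in Y follows b f w in Y, so b f is in J. Then b s is in J, c s is in Y, and phi(s) = 0
   contradicts phi(s) = 1. *)
have bK : b * f \in J.
  apply: winj; have -> : b * f * w = c * f - f * (c - b * w) by ring.
  by apply: submodB; [apply/cI/tju_f | apply: (rpredZ f)].
have : phi s = 0.
  rewrite -ctop; have : c * s \in mon_ideal N.+1 n.
    rewrite (_ : c * s = s * (c - b * w) + (b * s) * w); last by ring.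
    by apply: rpredD; [apply: (rpredZ s) | apply/wJ'/sK].
  by move=> /mon_idealP; apply=> i _; rewrite mnmE.
by move/eqP; rewrite phis oner_eq0.
Qed.

Lemma tju_sq_coord (u : R) : u \in idealM I I -> exists c, u - c * (f * f) \in idealM J I.
Proof.
move: u; apply: (@span_ind _ _ _ (fun u : R^o =>
  exists c : R, (u : R) - c * (f * f) \in idealM J I)).
- by exists 0; rewrite mul0r subr0; exact: rpred0.
- move=> x y [a xJ] [b yJ]; exists (a + b).
  by rewrite mulrDl opprD addrACA; apply: (rpredD xJ yJ).
move=> a _ [x [y [xI yI ->]]].
have [b xb] := tju_coord xI; have [c yc] := tju_coord yI.
exists (a * (b * c)).
have xyE : a * (x * y) - a * (b * c) * (f * f) =
    a * ((x - b * f) * y) + a * b * ((y - c * f) * f) by ring.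
rewrite [_ - _]xyE; apply: rpredD.
  by apply: (rpredZ a); apply: idealM_mem.
by apply: (rpredZ (a * b)); apply: idealM_mem => //; exact: tju_f.
Qed.

Lemma one_in_colon2 : (1 \in P) = (f * f \in idealM J I).
Proof. by rewrite colonE scale1r. Qed.

Lemma mul_ideal_tju_sq : {subset idealM J I <= idealM I I}.
Proof.
by apply: idealM_sub => x y xJ yI; apply: idealM_mem => //; apply: jac_sub_tju.
Qed.

Lemma tju_sq_eq : f * f \in idealM J I -> idealX I 2 =i idealM J I.
Proof.
move=> ffJI x; apply/idP/idP => [/tju_sq_coord[c xc]|]; last exact: mul_ideal_tju_sq.
rewrite -(subrK (c * (f * f)) x); apply: (rpredD xc); exact: (rpredZ c).
Qed.

(** The equality I^2 = J I propagates upwards, since multiplication by an element of I sends J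
    I^(m+1) into J I^(m+2). *)
Lemma reduction_number_one :
  has_reduction_number J I 1 <-> f * f \in idealM J I.
Proof.
split=> [[_ st _]|ffJI].
  by rewrite [_ \in _](st 1%N (leqnn 1)); apply: idealM_mem; exact: tju_f.
split=> // m; case: m => [//|m] _ x.
have sub m' : {subset idealM J (idealX I m'.+1) <= idealM I (idealX I m'.+1)}.
  by apply: idealM_sub => u v uJ vI; apply: idealM_mem => //; apply: jac_sub_tju.
apply/idP/idP; first exact: sub.
suff sup : {subset idealM I (idealX I m.+1) <= idealM J (idealX I m.+1)} by exact: sup.
elim: m {x} => [|m IHm]; first by move=> x; rewrite -(tju_sq_eq ffJI).
apply: idealM_sub => x y xI /IHm yJ.
have : {subset idealM J (idealX I m.+1) <= colon (idealM J (idealX I m.+2)) (x : R^o)}.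
  apply: idealM_sub => u v uJ vI; rewrite colonE [_ *: _]mulrC mulrCA.
  by apply: idealM_mem => //; apply: idealM_mem.
by move=> /(_ _ yJ); rewrite colonE [_ *: _]mulrC.
Qed.

End Hypersurface.

(** * Transfer of composition series and the final count *)

Section Assembly.
Variables (n : nat) (k : fieldType).
Local Notation R := (fps n k).

Lemma comp_series_quot (M : lmodType R) (L : submodClosed M) vs :
  comp_series L vs (fullmod M) ->
  comp_series (zeromod (quotmod L)) (map \pi_(quotmod L) vs) (fullmod (quotmod L)).
Proof.
apply: comp_transfer => [x _|x _|a x y _ _|x _|z _]; rewrite ?in_fullmod //.
- by rewrite quotmod_piD quotmod_piZ subrr rpred0.
- by rewrite zeromodE quotmod_pi_eq0.
by exists (repr z); rewrite ?in_fullmod // reprK subrr rpred0.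
Qed.

Lemma comp_series_nil (M : lmodType R) (L N : submodClosed M) vs :
  {subset N <= L} -> comp_series L vs N -> vs = [::].
Proof.
move=> NL; case: vs => // v vs [vL _ /comp_sub vN].
by case/negP: vL; apply/NL/vN/adjoin_mem.
Qed.

Variable f : R.
Hypothesis char0 : [pchar k] =i pred0.
Hypothesis f_isolated : isolated_singularity f.
Let J := jacobian_ideal f.
Let I := tjurina_ideal f.
Let K : ideal R := colon J (f : R^o).
Let P : ideal R := colon (idealM J I) (f * f : R^o).

(** Multiplication by f induces R/K = I/J. *)
Lemma comp_series_tju vs : comp_series K vs (fullmod R^o) ->
  comp_series J (map (fun c : R^o => c * f : R^o) vs) I.
Proof.
apply: comp_transfer.
- exact: jac_sub_tju.
- by move=> c _; apply: (rpredZ c); exact: tju_f.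
- move=> a x y _ _; rewrite (_ : _ - _ = 0) ?rpred0 //.
  by apply/eqP; rewrite subr_eq0 [_ * f]mulrDl [a *: (_ * _)]mulrA.
- by [].
move=> z /tju_coord[b zb]; exists b => //; exact: in_fullmod.
Qed.

Let ff : submod (idealX I 2).
Proof. by exists (f * f); apply: idealM_mem; exact: tju_f. Defined.

(** Multiplication by f^2 induces R/P = I^2/JI. *)
Lemma comp_series_sq vs : comp_series P vs (fullmod R^o) ->
  comp_series (zeromod (subquotmod (idealX I 2) (idealM J I)))
    (map (fun c : R^o => \pi_(subquotmod (idealX I 2) (idealM J I)) (c *: ff)) vs)
    (fullmod _).
Proof.
apply: comp_transfer => [x _|x _|a x y _ _|x _|z _]; rewrite ?in_fullmod //.
- by rewrite scalerDl -scalerA quotmod_piD quotmod_piZ subrr rpred0.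
- by rewrite zeromodE quotmod_pi_eq0.
have [c uc] := tju_sq_coord (valP (repr z)).
exists c; first exact: in_fullmod.
by rewrite zeromodE -[z in z - _]reprK -quotmod_piB quotmod_pi_eq0.
Qed.

Lemma delta_cover : exists g : R -> submod (ker_lin (@sym2_to_sq R I)),
  [/\ forall (a x y : R), x \in P -> y \in P -> g (a * x + y) = a *: g x + g y,
      forall c : R, c \in P -> g c = 0 <-> c \in K
    & forall z, exists2 c, c \in P & g c = z].
Proof.
have [N XJ] := jac_power f_isolated.
exact: (delta_presentation (@jac_mem n k f) (@jac_coord n k f) (tju_f f)
  (@jac_sub_tju n k f) (@tju_coord n k f) (jac_koszul XJ)).
Qed.

Lemma comp_series_delta vs : comp_series K vs P -> exists ws,
  comp_series (zeromod (submod (ker_lin (@sym2_to_sq R I)))) ws (fullmod _)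
  /\ size ws = size vs.
Proof.
have [g [glin gK gsurj]] := delta_cover.
move=> cP; exists (map g vs); split; last by rewrite size_map.
apply: comp_transfer cP => [x _|x _|a x y xP yP|x xP|z _]; rewrite ?in_fullmod //.
- by rewrite [a *: x + y]/(a * x + y) glin // subrr rpred0.
- by rewrite zeromodE; apply/eqP/idP => /(gK _ xP).
have [c cP <-] := gsurj z.
by exists c; rewrite // subrr rpred0.
Qed.

(** As delta(I) is P/K, it vanishes when f in J makes K all of R; conversely its vanishing gives P
    inside K, and [jac_of_colon] applies. *)
Lemma quasihomogeneous_delta :
  quasihomogeneous f <-> (forall x : delta I, x = 0 :> submod _).
Proof.
have [g [_ gK gsurj]] := delta_cover; split=> [fJ x | delta0].
  by have [c cP <-] := gsurj x; apply/(gK c cP); apply: (rpredZ c fJ).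
apply: (jac_of_colon char0 f_isolated) => c cP.
by apply/(gK c cP)/delta0.
Qed.

End Assembly.

Theorem theorem3p2 (n : nat) (k : fieldType) (f : fps n k)
    (n_ge2 : (2 <= n)%N) (char0 : [pchar k] =i pred0)
    (f_isolated : isolated_singularity f) :
  let J := jacobian_ideal f in
  let I := tjurina_ideal f in
  exists mu tau q d : nat,
    [/\ has_milnor_number f mu, has_tjurina_number f tau,
        has_length (subquotmod (idealX I 2) (idealM J I)) q
      & has_length (delta I) d] /\
    [/\ mu%:Z - tau%:Z = q%:Z + d%:Z,
        mu%:Z - tau%:Z = d%:Z <-> has_reduction_number J I 1,
        quasihomogeneous f <-> (forall x : delta I, x = 0)
      & mu%:Z - tau%:Z = 1 -> idealX I 2 =i idealM J I].
Proof.
move=> J I.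
pose K : ideal (fps n k) := colon J (f : (fps n k)^o).
pose P : ideal (fps n k) := colon (idealM J I) (f * f : (fps n k)^o).
have [N XJ] := jac_power f_isolated.
have JK : {subset J <= K} by move=> x xJ; rewrite colonE [_ *: _]mulrC; apply: (rpredZ f).
have KP : {subset K <= P} := colon_sub_colon2 (tju_f f).
have fullR (L : ideal (fps n k)) : {subset L <= fullmod (fps n k)^o}.
  by move=> x _; exact: in_fullmod.
have [vs cKP] := comp_exists (fun i => JK _ (XJ i)) KP.
have [ws cP] := comp_exists (fun i => KP _ (JK _ (XJ i))) (@fullR P).
have [us cI] := comp_exists (fun i => jac_sub_tju (XJ i)) (@fullR I).
(* The series from J to R passes through I; its part from J to I is f times the series from K
   through P to R. *)
have cJ := comp_cat (comp_series_tju (comp_cat cKP cP)) cI.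
have full (M : lmodType (fps n k)) (x : M) : x \in fullmod M := in_fullmod x.
have zero (M : lmodType (fps n k)) (x : M) : x \in zeromod M -> x = 0.
  by rewrite zeromodE => /eqP.
have [ds [cd sz_ds]] := comp_series_delta f_isolated cKP.
exists (size vs + size ws + size us)%N, (size us), (size ws), (size vs).
split; first split.
- have := comp_kdim (comp_series_quot cJ) (full _) (@zero _).
  by rewrite size_map size_cat size_map size_cat.
- by have := comp_kdim (comp_series_quot cI) (full _) (@zero _); rewrite size_map.
- by have := comp_length (comp_series_sq cP) (full _) (@zero _); rewrite size_map.
- by have := comp_length cd (full _) (@zero _); rewrite sz_ds.
have muE : (size vs + size ws + size us)%:Z - (size us)%:Z = (size ws)%:Z + (size vs)%:Z.
  by rewrite PoszD addrK PoszD addrC.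
(* The length of I^2/JI is 0 exactly when P = R, that is, when 1 lies in P. *)
have wsE : ws = [::] <-> f * f \in idealM J I.
  rewrite -one_in_colon2; split=> [ws0|P1].
    by move: cP; rewrite ws0 => /= ->; apply: full.
  apply: (comp_series_nil _ cP) => x _.
  by rewrite -[x]mulr1; apply: (rpredZ x P1).
rewrite !muE; split=> //.
- rewrite reduction_number_one -wsE; split=> [|->//].
  move=> /eqP; rewrite -[X in _ == X]add0r (inj_eq (addIr _)) => /eqP[].
  exact: size0nil.
- exact: quasihomogeneous_delta.
rewrite -PoszD => -[sz]; apply: tju_sq_eq.
(* The two lengths add up to 1. If [ws] is empty then f^2 is in JI; otherwise [vs] is empty, so P =
   K, f is in J, and again f^2 is in JI. *)
move: sz; case: (ws) wsE => [wsE _|w ws' _]; first exact: wsE.1.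
case: (vs) cKP => [cKP _|v vs' _]; last by rewrite /= addnS.
apply: idealM_mem; last exact: tju_f.
exact: (jac_of_colon char0 f_isolated (fun c (cP' : c \in P) => etrans (cKP c) cP')).
Qed.
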